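(* Let $\mathcal M_{\mathbf a}\in\overline{\mathcal A}$ and let $u\in C(\overline\Omega)$ be a viscosity solution of the equation $\mathcal M_{\mathbf a}(D^2u)=f$ in a bounded domain $\Omega\subset\mathbb R^n$, where $f$ is continuous and bounded. Assume that $\Omega$ satisfies the uniform exterior sphere condition (S) with radius $R>0$: for all $y\in\partial\Omega$ there is a ball $B_R$ of radius $R$ such that $y\in\partial B_R$ and $\overline\Omega\subset\overline B_R$. Assume also $u=g$ on $\partial\Omega$. (i) If $g\in C^\beta(\partial\Omega)$ with $\beta\in(0,1]$, then $$\sup_{x\in\Omega,\ y\in\partial\Omega}\frac{u(x)-u(y)}{|x-y|^{\beta/2}}\le C\left([g]_{\beta,\partial\Omega}+\|f^-\|_{L^\infty(\Omega)}\right)$$ with $C>0$ depending only on $n$, $\tilde a$, $R$ and $\beta$. (ii) Assume in addition that $\Omega$ has a uniform Lipschitz boundary with Lipschitz constant $L$. If $g\in C^{1,\beta}(\partial\Omega)$ with $\beta\in[0,1)$, then $$\sup_{x\in\Omega,\ y\in\partial\Omega}\frac{u(x)-u(y)}{|x-y|^{(1+\beta)/2}}\le C\left([g]_{1,\partial\Omega}+[Dg]_{\beta,\partial\Omega}+\|f^-\|_{L^\infty(\Omega)}\right)$$ with $C>0$ depending only on $n$, $\tilde a$, $R$, $L$ and $\beta$. If instead $u$ (lower semicontinuous on $\overline\Omega$) is a viscosity supersolution of the equation, then (i) and (ii) hold with $u(y)-u(x)$ and $\|f^+\|_{L^\infty(\Omega)}$ in place of $u(x)-u(y)$ and $\|f^-\|_{L^\infty(\Omega)}$,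 respectively.
   Context: For a real symmetric $n\times n$ matrix $X\in\mathcal S^n$, let $\lambda_1(X)\le\dots\le\lambda_n(X)$ be its eigenvalues. For $\mathbf a=(a_1,\dots,a_n)$ with $a_i\ge0$ for all $i$ and at least one $a_j>0$, set $\mathcal M_{\mathbf a}(X)=\sum_{i=1}^n a_i\lambda_i(X)$. $\overline{\mathcal A}$ is the class of all such operators; $\tilde a=(a_1+\dots+a_n)/n$. $f^+=\max(f,0)$, $f^-=\max(-f,0)$. Hölder notation: for $h:D\to\mathbb R$, $D\subset\mathbb R^n$, $[h]_{\beta,D}=\sup_{x\ne y\in D}|h(x)-h(y)|/|x-y|^\beta$ (same for vector-valued $h$). $g\in C^{1,\beta}(\partial\Omega)$ means that $g$ is the restriction of a $C^{1,\beta}$ function defined near $\partial\Omega$, and $Dg$ denotes its gradient. Viscosity notions: for an open set $\Omega$, an upper semicontinuous $u$ is a viscosity subsolution of $\mathcal M_{\mathbf a}(D^2u)=f$ (also written $\mathcal M_{\mathbf a}(D^2u)\ge f$) in $\Omega$ if $\mathcal M_{\mathbf a}(X)\ge f(x)$ for all $x\in\Omega$ and all $(\xi,X)\in\mathbb R^n\times\mathcal S^n$ such that $u(y)\le u(x)+\langle\xi,y-x\rangle+\frac12\langle X(y-x),y-x\rangle+o(|y-x|^2)$ as $y\to x$. A lower semicontinuous $u$ is a viscosity supersolution (written $\mathcal M_{\mathbf a}(D^2u)\le f$) if $\mathcal M_{\mathbf a}(X)\le f(x)$ for all $x\in\Omega$ and all $(\xi,X)$ such that $u(y)\ge u(x)+\langle\xi,y-x\rangle+\frac12\langle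 X(y-x),y-x\rangle+o(|y-x|^2)$ as $y\to x$. A viscosity solution is a continuous function that is both a sub- and a supersolution. *)

(* Defs.v *)
From HB Require Import structures.
From mathcomp Require Import all_boot all_order all_algebra.
From mathcomp Require Import complex.
From mathcomp Require Import all_classical all_reals all_analysis.

Set Implicit Arguments.
Unset Strict Implicit.
Unset Printing Implicit Defensive.

Import Order.TTheory GRing.Theory Num.Theory.
Import numFieldNormedType.Exports.

Local Open Scope classical_set_scope.
Local Open Scope ring_scope.

Section Euclidean.
Context {R : realType} {n : nat}.
Implicit Types (x y : 'rV[R]_n) (D : set 'rV[R]_n).

(* The norm `|x| that the library puts on 'rV[R]_n is the sup norm; it is used
   below only through the topology and the bounded sets it defines. *)
Definition dotv x y : R := \sum_i x 0 i * y 0 i.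
Definition enorm x : R := Num.sqrt (dotv x x).

Definition boundary D : set 'rV[R]_n := closure D `\` D°.

Definition grad (g : 'rV[R]_n -> R) x : 'rV[R]_n :=
  \row_i 'D_(delta_mx 0 i) g x.

(* [h]_{b,D}, for h with values in W normed by nrm: W is R with the absolute
   value, or R^n with the Euclidean norm. *)
Definition holder_semi (W : zmodType) (nrm : W -> R) (b : R) D
    (h : 'rV[R]_n -> W) : \bar R :=
  ereal_sup [set (nrm (h xy.1 - h xy.2) / enorm (xy.1 - xy.2) `^ b)%:E
            | xy in [set xy | [/\ D xy.1, D xy.2 & xy.1 != xy.2]]].

(* Lebesgue null sets of R^n: countable covers by closed boxes of arbitrarily
   small total volume. *)
Definition lebesgue_null D : Prop :=
  forall e : R, 0 < e -> exists lo hi : nat -> 'rV[R]_n,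
    [/\ forall k i, lo k 0 i <= hi k 0 i,
        D `<=` \bigcup_k [set x | forall i, lo k 0 i <= x 0 i <= hi k 0 i] &
        (\sum_(0 <= k <oo) (\prod_i (hi k 0 i - lo k 0 i))%:E <= e%:E)%E].

Definition Linfty_norm D (h : 'rV[R]_n -> R) : \bar R :=
  ereal_inf [set M%:E | M in
    [set M : R | 0 <= M /\ lebesgue_null (D `&` [set x | M < `|h x|])]].

(* {within D, continuous u} is continuity for the topology of [subspace D];
   semicontinuity relative to D is likewise taken in that topology. *)
Definition lsc_on D (u : 'rV[R]_n -> R) : Prop :=
  lower_semicontinuous ((EFin \o u) : subspace D -> \bar R).
Definition usc_on D (u : 'rV[R]_n -> R) : Prop := lsc_on D (\- u).

End Euclidean.

Section Operator.
Context {R : realType} {n : nat}.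
Implicit Types (a : 'I_n -> R) (X : 'M[R]_n) (u f : 'rV[R]_n -> R)
  (x xi : 'rV[R]_n) (Omega : set 'rV[R]_n).

(* lambda_1(X) <= ... <= lambda_n(X), repeated according to multiplicity.  For
   X symmetric such a sequence exists ([eigvalsP]) and is unique. *)
Definition is_eigvals X (l : seq R) : Prop :=
  sorted <=%R l /\ char_poly X = \prod_(c <- l) ('X - c%:P).
Definition eigvals X : seq R := xget [::] [set l | is_eigvals X l].

Lemma eigvalsP X : X^T = X -> is_eigvals X (eigvals X).
Proof.
move=> Xsym; rewrite /eigvals; case: xgetP => [l -> //|none]; exfalso.
pose toC := real_complex R; pose A := map_mx toC X.
have Aherm : A \is hermsymmx.
  apply: realsym_hermsym; first by apply/is_hermitianmxP;
    rewrite expr0 scale1r map_mx_id// /A map_trmx Xsym.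
  by apply/mxOverP => i j; rewrite mxE complex_real.
pose d := spectral_diag A; pose P := spectralmx A.
have dr j : toC (complex.Re (d 0 j)) = d 0 j.
  by apply: RRe_real; have /mxOverP := hermitian_spectral_diag_real Aherm.
have /orthomx_spectralP AE := hermitian_normalmx Aherm.
have Pu : P \in unitmx := spectral_unit A.
have charA : char_poly A = \prod_i ('X - (d 0 i)%:P).
  have -> : char_poly A = char_poly (diag_mx d).
    rewrite /char_poly /char_poly_mx {1}AE -/P -/d.
    have PP : map_mx polyC (invmx P) *m map_mx polyC P = 1%:M.
      by rewrite -map_mxM mulVmx// map_mx1.
    have -> : 'X%:M - map_mx polyC (invmx P *m diag_mx d *m P) =
        map_mx polyC (invmx P) *m ('X%:M - map_mx polyC (diag_mx d))
          *m map_mx polyC P.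
      rewrite mulmxBr mulmxBl !map_mxM; congr (_ - _).
      by rewrite scalar_mxC -mulmxA PP mulmx1.
    by rewrite !det_mulmx mulrAC -det_mulmx PP det1 mul1r.
  rewrite char_poly_trig ?diag_mx_is_trig//.
  by apply: eq_bigr => i _; rewrite mxE eqxx mulr1n.
apply: (none (sort <=%R [seq complex.Re (d 0 i) | i <- enum 'I_n])); split.
  exact/sort_sorted/le_total.
rewrite (perm_big _ (permEl (perm_sort _ _))) big_map big_enum /=.
apply: (map_poly_inj toC).
rewrite map_char_poly -/A charA rmorph_prod; apply: eq_bigr => i _.
by rewrite rmorphB /= map_polyX map_polyC -[in LHS]dr.
Qed.

Definition Mop a X : R := \sum_(i < n) a i * (eigvals X)`_i.

Definition in_Abar a : Prop := (forall i, 0 <= a i) /\ exists j, 0 < a j.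
Definition mean_coef a : R := (\sum_(i < n) a i) / n%:R.

Definition quad u x xi X (y : 'rV[R]_n) : R :=
  u x + dotv xi (y - x) + 2^-1 * dotv ((y - x) *m X) (y - x).

Definition superjet u x xi X : Prop :=
  X^T = X /\ forall e : R, 0 < e ->
    \forall y \near x, u y <= quad u x xi X y + e * enorm (y - x) ^+ 2.
Definition subjet u x xi X : Prop :=
  X^T = X /\ forall e : R, 0 < e ->
    \forall y \near x, u y >= quad u x xi X y - e * enorm (y - x) ^+ 2.

Definition visc_subsol a Omega f u : Prop :=
  usc_on Omega u /\
  forall x, Omega x -> forall xi X, superjet u x xi X -> f x <= Mop a X.
Definition visc_supersol a Omega f u : Prop :=
  lsc_on Omega u /\
  forall x, Omega x -> forall xi X, subjet u x xi X -> Mop a X <= f x.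
Definition visc_sol a Omega f u : Prop :=
  [/\ {within Omega, continuous u}, visc_subsol a Omega f u &
      visc_supersol a Omega f u].

End Operator.

Section Domains.
Context {R : realType} {n : nat}.
Implicit Types (Omega U : set 'rV[R]_n) (g : 'rV[R]_n -> R).

Definition bounded_domain Omega : Prop :=
  [/\ open Omega, Omega !=set0, connected Omega & bounded_set Omega].

Definition exterior_sphere (rad : R) Omega : Prop :=
  forall y, boundary Omega y -> exists z,
    enorm (y - z) = rad /\ closure Omega `<=` [set x | enorm (x - z) <= rad].

(* R^{n-1} is realized as the hyperplane orthogonal to the unit vector e, the
   vertical axis of the chart at y: near y, Omega is the set of points lying
   above the graph of phi.  The size r of the charts does not depend on y. *)
Definition lipschitz_boundary (L : R) Omega : Prop :=
  exists2 r : R, 0 < r &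
  forall y, boundary Omega y -> exists (e : 'rV[R]_n) (phi : 'rV[R]_n -> R),
    [/\ enorm e = 1,
        forall p q, dotv p e = 0 -> dotv q e = 0 ->
          `|phi p - phi q| <= L * enorm (p - q) &
        forall x, enorm (x - y) < r ->
          (Omega x <-> phi (x - dotv x e *: e) < dotv x e)].

Definition C1holder (b : R) U g : Prop :=
  [/\ forall x, U x -> differentiable g x,
      {within U, continuous (grad g)} &
      (holder_semi enorm b U (grad g) < +oo)%E].

(* g stands for both the boundary datum (its values on the boundary) and its
   extension near the boundary, whose gradient is the Dg of the estimate. *)
Definition C1holder_boundary (b : R) Omega g : Prop :=
  exists U, [/\ open U, boundary Omega `<=` U & C1holder b U g].

End Domains.

(* Main.v *)
Require Import Defs.
From HB Require Import structures.
From mathcomp Require Import all_boot all_order all_algebra.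
From mathcomp Require Import all_classical all_reals all_analysis.
From mathcomp Require Import measurable_realfun.
From mathcomp Require Import ring lra.

Set Implicit Arguments.
Unset Strict Implicit.
Unset Printing Implicit Defensive.

Import Order.TTheory GRing.Theory Num.Theory.
Import numFieldNormedType.Exports.

Local Open Scope classical_set_scope.
Local Open Scope ring_scope.

(** Why the estimates hold.  Let z be the centre of the ball at a boundary point y,
    and N = z - y.  The inclusion of Omega in the ball reads

      |p - y|^2 <= l(p) := 2 <p - y, N>        for p in the closure of Omega,

    so the affine function l vanishes at y, dominates the squared distance to y, and
    is at most 2 rad |p - y|.  If the boundary values satisfy
    g(p) - g(y) <= <p - y, xi> + H l(p)^s with 0 <= s <= 1, then by concavity
    l^s <= d^s (1 + l / d) for every d > 0, and

      g(y) + <p - y, xi> + H d^s (1 + l(p) / d) + c (l(p) - |p - y|^2)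

    lies above g on the boundary.  Its Hessian is -2 c I, on which the operator takes
    the value -2 c (a_1 + ... + a_n), whatever the individual coefficients: it is a
    strict supersolution once c is large with respect to the negative part of f.
    Comparison holds at a maximum of the difference, and evaluating at x with
    d = |x - y| gives a bound of order |x - y|^s ([barrier_estimate]).

    For g Hoelder of exponent beta one has |p - y|^beta <= l(p)^(beta/2), hence
    s = beta/2 and xi = 0.

    For g of class C^{1,beta}, xi is the gradient of g at y and s = (1 + beta)/2.  The
    required remainder estimate ([boundary_taylor]) is obtained by integrating along
    a path from y to p in the boundary, of length at most 7 sqrt(l(p)).  In dimension
    at least 2 such a path exists because Omega is convex ([segment_in]), so that the
    nearest point projection onto its closure is a contraction and maps the exterior
    to the boundary: it suffices to go from y to p outside Omega.  In dimension 1 the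
    Lipschitz constant of g on the boundary replaces it.  It remains to bound
    <x - y, xi> by means of boundary values only: the remainder estimate at the point
    where the ray from y through x leaves Omega does it ([slope_bound]).

    The essential bound on f is a pointwise one, since f is continuous and a null set
    has no interior ([open_not_null]).  Finally the opposite of a supersolution has
    the property of subsolutions on which the barriers rest ([scalar_subsol]). *)

(** * The Euclidean norm on row vectors *)

Section Euclid.
Context {R : realType} {n : nat}.
Implicit Types (x y z p q v w : 'rV[R]_n).

Lemma dotvC x y : dotv x y = dotv y x.
Proof. by apply: eq_bigr => i _; rewrite mulrC. Qed.

Lemma dotvDl x y z : dotv (x + y) z = dotv x z + dotv y z.
Proof. by rewrite /dotv -big_split; apply: eq_bigr => i _; rewrite mxE mulrDl. Qed.

Lemma dotvZl (c : R) x z : dotv (c *: x) z = c * dotv x z.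
Proof. by rewrite /dotv mulr_sumr; apply: eq_bigr => i _; rewrite mxE mulrA. Qed.

Lemma dotvDr x y z : dotv z (x + y) = dotv z x + dotv z y.
Proof. by rewrite dotvC dotvDl !(dotvC z). Qed.

Lemma dotvZr (c : R) x z : dotv z (c *: x) = c * dotv z x.
Proof. by rewrite dotvC dotvZl dotvC. Qed.

Lemma dotvNl x z : dotv (- x) z = - dotv x z.
Proof. by rewrite -scaleN1r dotvZl mulN1r. Qed.

Lemma dotvNr x z : dotv z (- x) = - dotv z x.
Proof. by rewrite dotvC dotvNl dotvC. Qed.

Definition dotvE := (dotvDl, dotvDr, dotvNl, dotvNr, dotvZl, dotvZr).

Lemma dotv0l z : dotv 0 z = 0.
Proof. by rewrite -(scale0r z) dotvZl mul0r. Qed.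

Lemma dotvv_ge0 x : 0 <= dotv x x.
Proof. by apply: sumr_ge0 => i _; rewrite -expr2 sqr_ge0. Qed.

Lemma enorm_ge0 x : 0 <= enorm x.
Proof. exact: sqrtr_ge0. Qed.

Lemma enorm_sqr x : enorm x ^+ 2 = dotv x x.
Proof. by rewrite sqr_sqrtr // dotvv_ge0. Qed.

Lemma enorm_eq0 x : enorm x = 0 -> x = 0.
Proof.
move=> x0; apply/rowP => i; rewrite mxE.
have /eqP : dotv x x = 0 by rewrite -enorm_sqr x0 expr0n.
rewrite psumr_eq0 => [/allP /(_ i)|j _]; last by rewrite -expr2 sqr_ge0.
by rewrite mem_index_enum -expr2 sqrf_eq0 => /(_ isT) /eqP.
Qed.

Lemma enorm_gt0 x : x != 0 -> 0 < enorm x.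
Proof.
by move=> x0; rewrite lt_def enorm_ge0 andbT; apply: contraNneq x0 => /enorm_eq0 ->.
Qed.

Lemma enormZ (c : R) x : enorm (c *: x) = `|c| * enorm x.
Proof.
by rewrite /enorm !dotvE mulrA -expr2 sqrtrM ?sqr_ge0// sqrtr_sqr.
Qed.

Lemma enormN x : enorm (- x) = enorm x.
Proof. by rewrite -scaleN1r enormZ normrN1 mul1r. Qed.

Lemma enormC x y : enorm (x - y) = enorm (y - x).
Proof. by rewrite -opprB enormN. Qed.

Lemma enorm0 : enorm (0 : 'rV[R]_n) = 0.
Proof. by rewrite -(scale0r 0) enormZ normr0 mul0r. Qed.

Lemma cauchy_schwarz x y : `|dotv x y| <= enorm x * enorm y.
Proof.
have [->|y0] := eqVneq y 0.
  by rewrite dotvC dotv0l normr0 mulr_ge0// enorm_ge0.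
have y2 : 0 < dotv y y by rewrite -enorm_sqr exprn_gt0// enorm_gt0.
rewrite -(@ler_pXn2r _ 2)// ?nnegrE ?mulr_ge0 ?enorm_ge0//.
rewrite exprMn !enorm_sqr real_normK ?num_real//.
have := dotvv_ge0 (dotv y y *: x - dotv x y *: y).
rewrite !dotvE (dotvC y x).
set a := dotv x x; set b := dotv x y; set c := dotv y y in y2 * => h.
have : 0 <= c * (a * c - b ^+ 2) by lra.
by rewrite pmulr_rge0// subr_ge0.
Qed.

Lemma sqr_enormB x y :
  enorm (x - y) ^+ 2 = dotv x x - 2 * dotv x y + dotv y y.
Proof. rewrite enorm_sqr !dotvE (dotvC y x); ring. Qed.

Lemma enormD x y : enorm (x + y) <= enorm x + enorm y.
Proof.
rewrite -(@ler_pXn2r _ 2)// ?nnegrE ?addr_ge0 ?enorm_ge0//.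
rewrite enorm_sqr !dotvE sqrrD !enorm_sqr (dotvC y x).
have := ler_norm (dotv x y); have := cauchy_schwarz x y; lra.
Qed.

Lemma mxnorm_le_enorm x : `|x| <= enorm x.
Proof.
rewrite /Num.norm /= mx_normrE; apply: bigmax_le => [|[i j] _ /=].
  exact: enorm_ge0.
rewrite (ord1 i) -[leLHS]sqrtr_sqr ler_sqrt ?dotvv_ge0//.
rewrite /dotv (bigD1 j)//= -expr2 lerDl.
by apply: sumr_ge0 => k _; rewrite -expr2 sqr_ge0.
Qed.

Lemma coordB_cvg q i x :
  (fun y : 'rV[R]_n => (y - q) 0 i) y @[y --> x] --> (x - q) 0 i.
Proof.
have E (y : 'rV[R]_n) : (y - q) 0 i = y 0 i - q 0 i by rewrite !mxE.
rewrite E (eq_cvg _ _ E).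
exact: (cvgB (@coord_continuous R 1 n 0 i x) (cvg_cst _)).
Qed.

Lemma dotv_continuous q w : continuous (fun x => dotv (x - q) w).
Proof.
rewrite /dotv; apply: continuous_big => [|i _ x]; first exact: add_continuous.
exact: (cvgM (@coordB_cvg q i x) (cvg_cst _)).
Qed.

Lemma sqr_enorm_continuous q : continuous (fun x => enorm (x - q) ^+ 2).
Proof.
under eq_fun do rewrite enorm_sqr.
rewrite /dotv; apply: continuous_big => [|i _ x]; first exact: add_continuous.
exact: (cvgM (@coordB_cvg q i x) (@coordB_cvg q i x)).
Qed.

End Euclid.

(** * Domains with the uniform exterior sphere property *)

(** The sets where w is at least one of its values on K form a filter base, by
    totality of the order; upper semicontinuity makes any of its cluster points
    a maximum point. *)
Lemma usc_attains_max (R : realType) (T : topologicalType) (K : set T) (w : T -> R) :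
  compact K -> K !=set0 ->
  (forall p m, K p -> w p < m -> \forall x \near p, K x -> w x < m) ->
  exists2 p, K p & forall x, K x -> w x <= w p.
Proof.
move=> cK [k Kk] usc.
pose F : set_system T :=
  [set A | exists2 x0, K x0 & forall x, K x -> w x0 <= w x -> A x].
have FF : ProperFilter F.
  split; first by case=> x0 Kx0 /(_ _ Kx0 (lexx _)).
  split; first by exists k.
  - move=> A B [x1 K1 h1] [x2 K2 h2].
    case: (leP (w x1) (w x2)) => h.
      by exists x2 => // x Kx wx; split; [apply/h1/(le_trans h)|apply/h2].
    by exists x1 => // x Kx wx; split; [apply/h1|apply/h2/(le_trans (ltW h))].
  - by move=> A B AB [x0 K0 h]; exists x0 => // x Kx wx; apply/AB/h.
have [p [Kp clp]] := cK F FF (ex_intro2 _ _ k Kk (fun x Kx _ => Kx)).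
exists p => // x Kx; rewrite leNgt; apply/negP => wpx.
have [z [[Kz wz] /(_ Kz)]] := clp _ _
  (ex_intro2 _ _ x Kx (fun z Kz wz => conj Kz wz) : F [set z | K z /\ w x <= w z])
  (usc p _ Kp wpx).
by rewrite ltNge wz.
Qed.

Section Convex.
Context {R : realType} {n : nat}.
Implicit Types (Omega : set 'rV[R]_n) (x y z p q v w a b c N : 'rV[R]_n).

Lemma boundary_open Omega p : open Omega ->
  boundary Omega p <-> closure Omega p /\ ~ Omega p.
Proof. by move=> /interior_id oO; rewrite /boundary oO. Qed.

Lemma inside_sub_boundary_neq0 Omega x y : open Omega ->
  Omega x -> boundary Omega y -> x - y != 0.
Proof.
move=> oO Ox /(boundary_open _ oO)[_ nOy].
by rewrite subr_eq0; apply/eqP => xy; apply: nOy; rewrite -xy.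
Qed.

Lemma near_segment a c (s e : R) : 0 < e ->
  exists2 d : R, 0 < d &
    forall t, `|t - s| < d -> enorm ((a + t *: c) - (a + s *: c)) < e.
Proof.
move=> e0; have c0 := enorm_ge0 c.
exists (e / (enorm c + 1)) => [|t]; first by rewrite divr_gt0// ltr_wpDl.
rewrite ltr_pdivlMr ?ltr_wpDl// => h.
rewrite opprD addrACA subrr add0r -scalerBl enormZ.
apply: le_lt_trans h; rewrite ler_wpM2l// lerDl//.
Qed.

Lemma open_enorm Omega p : open Omega -> Omega p ->
  exists2 e : R, 0 < e & forall q, enorm (q - p) < e -> Omega q.
Proof.
move=> oO Op; have /nbhs_normP[e /= e0 h] := open_nbhs_nbhs (conj oO Op).
exists e => // q qp; apply: h => /=.
by apply: le_lt_trans qp; rewrite distrC mxnorm_le_enorm.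
Qed.

Lemma open_segment Omega a c (s : R) : open Omega -> Omega (a + s *: c) ->
  exists2 d : R, 0 < d & forall t, `|t - s| < d -> Omega (a + t *: c).
Proof.
move=> oO /(open_enorm oO)[e e0 h]; have [d d0 hd] := near_segment a c s e0.
by exists d => // t /hd /h.
Qed.

(** The first parameter at which the segment is outside the open set gives a
    point outside it that is a limit of points of it. *)
Lemma segment_meets_boundary Omega a c : open Omega -> Omega a -> ~ Omega c ->
  exists2 s : R, 0 < s <= 1 & boundary Omega (a + s *: (c - a)).
Proof.
move=> oO Oa nOc.
pose E : set R := [set t | 0 <= t /\ ~ Omega (a + t *: (c - a))].
have E1 : E 1 by split=> //; rewrite scale1r addrC subrK.
have infE : has_inf E by split; [exists 1|exists 0 => t []].
have s1 : inf E <= 1 by apply: ge_inf => //; case: infE.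
have s0 : 0 <= inf E by apply: lb_le_inf; [exists 1|move=> t []].
have below t : 0 <= t -> t < inf E -> Omega (a + t *: (c - a)).
  move=> t0; apply: contraPP => nO; apply/negP; rewrite -leNgt.
  by apply: ge_inf => //; case: infE.
have nOs : ~ Omega (a + inf E *: (c - a)).
  move=> /(open_segment oO)[d d0 hd].
  have [e Ee es] := inf_adherent d0 infE.
  have ie : inf E <= e by apply: ge_inf => //; case: infE.
  by case: Ee => _; apply; apply: hd; rewrite ger0_norm; lra.
have s_gt0 : 0 < inf E.
  rewrite lt_def s0 andbT; apply/eqP => s_eq0; apply: nOs.
  by rewrite s_eq0 scale0r addr0.
exists (inf E); first by rewrite s_gt0.
apply/boundary_open => //; split=> // B /nbhs_normP[e /= e0 hB].
have [d d0 hd] := near_segment a (c - a) (inf E) e0.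
pose t := Num.max 0 (inf E - d / 2).
have t0 : 0 <= t by rewrite le_max lexx.
have ts : t < inf E by rewrite gt_max s_gt0 /=; lra.
have td : inf E - d / 2 <= t by rewrite le_max lexx orbT.
exists (a + t *: (c - a)); split; first exact: below.
apply: hB => /=; rewrite distrC; apply: le_lt_trans (mxnorm_le_enorm _) _.
by apply: hd; rewrite ler0_norm; lra.
Qed.

(** With N = z - y, where z is the centre of the sphere at y, the ball condition
    |p - z| <= rad reads |p - y|^2 <= 2 <p - y, N>.  The affine function on the
    right is the one from which all barriers are made. *)
Definition inner_normal (rad : R) Omega y N : Prop :=
  enorm N = rad /\
  forall p, closure Omega p -> enorm (p - y) ^+ 2 <= 2 * dotv (p - y) N.

Lemma exterior_sphere_normal (rad : R) Omega y :
  exterior_sphere rad Omega -> boundary Omega y ->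
  exists N, inner_normal rad Omega y N.
Proof.
move=> S /S[z [yz ball]]; exists (z - y).
rewrite enormC in yz; split=> // p /ball /= pz.
have : enorm (p - z) ^+ 2 <= rad ^+ 2.
  by rewrite ler_pXn2r// ?nnegrE ?enorm_ge0// -yz enorm_ge0.
rewrite -yz (_ : p - z = (p - y) - (z - y)); last by rewrite opprB addrA subrK.
move: (p - y) (z - y) => A B; rewrite !enorm_sqr !dotvE (dotvC B A); lra.
Qed.

Lemma inner_normal_ge0 rad Omega y N p : inner_normal rad Omega y N ->
  closure Omega p -> 0 <= dotv (p - y) N.
Proof.
by move=> [_ h] /h; have := sqr_ge0 (enorm (p - y)) => ? ?; lra.
Qed.

Lemma inner_normal_le rad Omega y N p : inner_normal rad Omega y N ->
  2 * dotv (p - y) N <= 2 * rad * enorm (p - y).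
Proof.
move=> [NR _]; rewrite -NR -mulrA ler_wpM2l// mulrC.
exact: le_trans (ler_norm _) (cauchy_schwarz _ _).
Qed.

Lemma inner_normal_diam rad Omega y N p : inner_normal rad Omega y N ->
  closure Omega p -> enorm (p - y) <= 2 * rad.
Proof.
move=> HN Cp; have := le_trans (HN.2 p Cp) (inner_normal_le p HN).
have [->|/enorm_gt0 h] := eqVneq (p - y) 0.
  by rewrite enorm0 -HN.1 mulr_ge0 ?enorm_ge0.
by rewrite expr2 ler_pM2r.
Qed.

(** The exterior sphere property forces convexity.  At the first exit point of
    the segment from a, the inner normal N satisfies <b - a, N> >= 0 because of b,
    whereas a itself lies strictly on the inner side, which requires
    <b - a, N> < 0. *)
Lemma segment_in rad Omega a b (t : R) : open Omega ->
  exterior_sphere rad Omega -> Omega a -> closure Omega b ->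
  0 <= t < 1 -> Omega (a + t *: (b - a)).
Proof.
move=> oO S Oa Cb /andP[t0 t1]; apply: contrapT => nO.
have [s /andP[s0 s1] bd] := segment_meets_boundary oO Oa nO.
have [N HN] := exterior_sphere_normal S bd.
have nOy := (boundary_open _ oO).1 bd.
move: bd HN nOy; rewrite addrAC subrr add0r scalerA.
set r := s * t => bd HN nOy.
have r1 : r < 1 by rewrite /r; nra.
have rge0 : 0 <= r by rewrite mulr_ge0// ltW.
have Ea := HN.2 a (subset_closure Oa); have Eb := inner_normal_ge0 HN Cb.
have ab : b - (a + r *: (b - a)) = (1 - r) *: (b - a).
  by rewrite scalerBl scale1r opprD addrA.
move: Ea Eb; rewrite ab opprD addrA subrr add0r enormN dotvNl !dotvZl => Ea Eb.
have D0 : 0 <= dotv (b - a) N by move: Eb; rewrite pmulr_rge0// subr_gt0.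
have : enorm (r *: (b - a)) <= 0.
  rewrite -(@ler_pXn2r _ 2)// ?nnegrE ?enorm_ge0// expr0n /=.
  by apply: le_trans Ea _; have := mulr_ge0 rge0 D0; lra.
move=> h; apply: nOy.2.
have -> : r *: (b - a) = 0 by apply: enorm_eq0; apply/le_anti; rewrite h enorm_ge0.
by rewrite addr0.
Qed.

(** The nearest point projection onto the closure, singled out by the obtuse angle
    condition, which is what the contraction property uses. *)
Definition proj Omega q : 'rV[R]_n :=
  xget 0 [set w | closure Omega w /\
                  forall p, closure Omega p -> dotv (q - w) (p - w) <= 0].

Lemma closure_halfspace Omega q v (c : R) :
  (forall p, Omega p -> dotv (p - q) v <= c) ->
  forall p, closure Omega p -> dotv (p - q) v <= c.
Proof.
move=> h p Cp; rewrite leNgt; apply/negP => lt.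
have /cvgr_gt /(_ c lt) /Cp[x [Ox /= xc]] := @dotv_continuous R n q v p.
by have := h _ Ox; rewrite leNgt xc.
Qed.

Lemma bounded_closure_compact Omega : bounded_set Omega ->
  compact (closure Omega).
Proof.
move=> [M [_ hM]]; apply: bounded_closed_compact; last exact: closed_closure.
exists (M + 2); split; first exact: num_real.
move=> r Mr p Cp; have [x [Ox xp]] := Cp _ (nbhsx_ballx p 1 ltr01).
have xM : `|x| <= M + 1 by apply: hM => //; rewrite ltrDl.
have px : `|p - x| < 1 by move: xp; rewrite -ball_normE.
rewrite -(subrK x p); apply: le_trans (ler_normD _ _) _.
by lra.
Qed.

(** At a point w of the closure nearest to q the angle condition holds against
    every p in Omega, because by convexity the segment from p to w stays in the
    closure; it passes to limits of such p. *)
Lemma projP rad Omega q : bounded_domain Omega -> exterior_sphere rad Omega ->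
  closure Omega (proj Omega q) /\
  forall p, closure Omega p -> dotv (q - proj Omega q) (p - proj Omega q) <= 0.
Proof.
move=> [oO [a Oa] _ bO] S; rewrite /proj; case: xgetP => [w -> //|none]; exfalso.
have [| |w Cw wmin] := @usc_attains_max R _ _ (fun w => - enorm (w - q) ^+ 2)
    (bounded_closure_compact bO).
- by exists a; exact: subset_closure.
- move=> p m _ pm; have /cvgr_gt /(_ (- m)) := @sqr_enorm_continuous R n q p.
  have -> : - m < enorm (p - q) ^+ 2 by lra.
  move=> /(_ isT); apply: filterS => x xm _; lra.
apply: (none w); split=> // p Cp.
rewrite dotvC; apply: closure_halfspace Cp => {}p Op.
rewrite leNgt; apply/negP => D0.
pose v := p - w; set D := dotv v (q - w) in D0.
have v2 : 0 <= dotv v v := dotvv_ge0 v.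
pose t := D / (D + dotv v v).
have t0 : 0 < t by rewrite divr_gt0// ltr_pwDl.
have t1 : t <= 1 by rewrite ler_pdivrMr ?mul1r ?lerDl// ltr_pwDl.
have tv : t * dotv v v < 2 * D.
  rewrite /t mulrAC ltr_pdivrMr ?ltr_pwDl//; nra.
have Ct : closure Omega (p + (1 - t) *: (w - p)).
  by apply/subset_closure/(segment_in oO S); rewrite // subr_ge0 t1 /= ltrBlDl ltrDr.
have := wmin _ Ct.
have -> : p + (1 - t) *: (w - p) - q = t *: v - (q - w).
  by rewrite /v; apply/rowP => i; rewrite !mxE; ring.
rewrite lerN2 -opprB enormN => h.
move: h; rewrite enorm_sqr sqr_enormB !dotvZl dotvZr -/D => h.
have : t * (2 * D - t * dotv v v) > 0 by rewrite mulr_gt0// subr_gt0.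
lra.
Qed.

Lemma proj_closure_id rad Omega q : bounded_domain Omega ->
  exterior_sphere rad Omega -> closure Omega q -> proj Omega q = q.
Proof.
move=> bd S /(projP q bd S).2 h; apply/esym/eqP; rewrite -subr_eq0; apply/eqP.
apply: enorm_eq0; apply/eqP; rewrite -sqrf_eq0 enorm_sqr.
by apply/eqP/le_anti; rewrite h dotvv_ge0.
Qed.

(** If the projection w were interior, moving it slightly towards q would stay in
    Omega and violate the angle condition. *)
Lemma proj_boundary rad Omega q : bounded_domain Omega ->
  exterior_sphere rad Omega -> ~ Omega q -> boundary Omega (proj Omega q).
Proof.
move=> bd S nOq; have oO : open Omega by case: bd.
have [Cw hw] := projP q bd S; apply/boundary_open => //; split=> // Ow.
have Ow' : Omega (proj Omega q + 0 *: (q - proj Omega q)) by rewrite scale0r addr0.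
have [d d0 hd] := open_segment oO Ow'.
have d2 : `|d / 2 - 0| < d by rewrite subr0 ger0_norm; lra.
have := hw _ (subset_closure (hd _ d2)).
rewrite addrAC subrr add0r dotvZr pmulr_rle0 ?divr_gt0// => h.
apply: nOq; rewrite -(subrK (proj Omega q) q) (_ : q - _ = 0) ?add0r//.
apply: enorm_eq0; apply/eqP; rewrite -sqrf_eq0 enorm_sqr.
by apply/eqP/le_anti; rewrite h dotvv_ge0.
Qed.

Lemma proj_contract rad Omega p q : bounded_domain Omega ->
  exterior_sphere rad Omega ->
  enorm (proj Omega p - proj Omega q) <= enorm (p - q).
Proof.
move=> bd S; have [Cp hp] := projP p bd S; have [Cq hq] := projP q bd S.
have := hp _ Cq; have := hq _ Cp; set P := proj _ p; set Q := proj _ q => h1 h2.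
have h : dotv (P - Q) (P - Q) <= dotv (p - q) (P - Q).
  by move: h1 h2; rewrite !dotvE; lra.
have [->|PQ] := eqVneq (P - Q) 0; first by rewrite enorm0 enorm_ge0.
rewrite -(ler_pM2r (enorm_gt0 PQ)) -expr2 enorm_sqr.
exact: le_trans h (le_trans (ler_norm _) (cauchy_schwarz _ _)).
Qed.

End Convex.

(** * Taylor expansion along the boundary *)

(** A mean value inequality that asks for a bound on the difference quotients at
    each point, with no derivative: it is applied to functions composed with a
    nearest point projection, which is Lipschitz but need not be
    differentiable. *)
Lemma pointwise_lipschitz (R : realType) (F : R -> R) (M : R) :
  (forall t e, 0 <= t <= 1 -> 0 < e -> exists2 d : R, 0 < d &
     forall s, 0 <= s <= 1 -> `|s - t| < d ->
       `|F s - F t| <= (M + e) * `|s - t|) ->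
  `|F 1 - F 0| <= M.
Proof.
move=> loc; apply/ler_addgt0Pr => e e0.
pose E : set R := [set t | 0 <= t <= 1 /\ `|F t - F 0| <= (M + e) * t].
have E0 : E 0 by split; rewrite ?lexx ?ler01// subrr normr0 mulr0.
have supE : has_sup E by split; [exists 0|exists 1 => t [/andP[]]].
have s0 : 0 <= sup E by apply: ub_le_sup => //; case: supE.
have s1 : sup E <= 1 by apply: ge_sup; [exists 0|move=> t [/andP[]]].
have s01 : 0 <= sup E <= 1 by rewrite s0 s1.
have [d d0 hd] := loc _ _ s01 e0.
have chain t s : `|F t - F 0| <= (M + e) * t -> t <= s ->
    `|F s - F t| <= (M + e) * `|s - t| -> `|F s - F 0| <= (M + e) * s.
  move=> h1 ts; rewrite (@ger0_norm _ (s - t)) ?subr_ge0// => h2.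
  by rewrite -(subrKA (F t) (F s)); apply: le_trans (ler_normD _ _) _; lra.
have [t Et tlt] := sup_adherent d0 supE.
have tle : t <= sup E by apply: ub_le_sup => //; case: supE.
have td : `|t - sup E| < d by rewrite ler0_norm; lra.
have Es : `|F (sup E) - F 0| <= (M + e) * sup E.
  case: Et => t01 ht; apply: chain ht tle _.
  by rewrite distrC [X in _ * X]distrC; exact: hd.
pose s := Num.min 1 (sup E + d / 2).
have s_ge : sup E <= s by rewrite le_min s1 /=; lra.
have s_le : s <= 1 by rewrite ge_min lexx.
have s_le' : s <= sup E + d / 2 by rewrite ge_min lexx orbT.
have s_01 : 0 <= s <= 1 by lra.
have sd : `|s - sup E| < d by rewrite ger0_norm; lra.
have Ess : E s by split=> //; exact: chain Es s_ge (hd _ s_01 sd).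
have s_sup : s <= sup E by apply: ub_le_sup => //; case: supE.
have s_eq : sup E = 1.
  by move: s_sup; rewrite /s ge_min => /orP[h|h]; [apply/le_anti; rewrite s1|lra].
by move: Es; rewrite s_eq mulr1.
Qed.

Section BoundaryTaylor.
Context {R : realType} {n : nat}.
Implicit Types (Omega : set 'rV[R]_n) (g : 'rV[R]_n -> R)
  (x y z p q v w a b c xi N : 'rV[R]_n).

Lemma differential_grad g x v : differentiable g x ->
  'd g x v = dotv (grad g x) v.
Proof.
move=> dg; rewrite {1}(row_sum_delta v) linear_sum /dotv; apply: eq_bigr => i _.
by rewrite linearZ /= mxE deriveE// mulrC.
Qed.

Lemma first_order_expansion g x : differentiable g x -> forall e : R, 0 < e ->
  exists2 d : R, 0 < d & forall w, enorm (w - x) < d ->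
    `|g w - g x - dotv (grad g x) (w - x)| <= e * enorm (w - x).
Proof.
move=> dg e e0; have /eqaddoP /(_ e e0) := diff_locally dg.
move=> /nbhs_normP[d /= d0 h]; exists d => // w wx.
have := h (w - x); rewrite /= sub0r normrN => /(_ (le_lt_trans (mxnorm_le_enorm _) wx)).
rewrite !fctE /= /shift subrK opprD addrA differential_grad// => H.
by apply: le_trans H _; rewrite ler_wpM2l ?mxnorm_le_enorm// ltW.
Qed.

(** A segment outside Omega projects to a curve in the boundary whose speed is at
    most that of the segment, and only the values of the gradient of g on that
    curve enter the bound. *)
Lemma projected_segment rad Omega g xi a c (M : R) :
  bounded_domain Omega -> exterior_sphere rad Omega ->
  (forall p, boundary Omega p -> differentiable g p) ->
  (forall t, 0 <= t <= 1 -> ~ Omega (a + t *: c)) ->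
  (forall t, 0 <= t <= 1 ->
     enorm (grad g (proj Omega (a + t *: c)) - xi) <= M) ->
  `|(g (proj Omega (a + c)) - g (proj Omega a)) -
    dotv xi (proj Omega (a + c) - proj Omega a)| <= M * enorm c.
Proof.
move=> bd S dg out gradM.
pose P t := proj Omega (a + t *: c).
pose F t := g (P t) - dotv xi (P t).
have FE s t : F s - F t = g (P s) - g (P t) - dotv xi (P s - P t).
  by rewrite /F dotvDr dotvNr; ring.
have P1 : P 1 = proj Omega (a + c) by rewrite /P scale1r.
have P0 : P 0 = proj Omega a by rewrite /P scale0r addr0.
rewrite -P1 -P0 -FE; apply: pointwise_lipschitz => t e t01 e0.
have c1 : 0 < enorm c + 1 by rewrite ltr_wpDl// enorm_ge0.
have M0 : 0 <= M := le_trans (enorm_ge0 _) (gradM t t01).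
pose e' := e / (enorm c + 1); have e'0 : 0 < e' by rewrite divr_gt0.
have [d d0 hd] := first_order_expansion
  (dg _ (proj_boundary bd S (out t t01))) e'0.
exists (d / (enorm c + 1)) => [|s s01]; first by rewrite divr_gt0.
rewrite ltr_pdivlMr// => sd.
have PP : enorm (P s - P t) <= `|s - t| * enorm c.
  apply: le_trans (proj_contract _ _ bd S) _.
  by rewrite opprD addrACA subrr add0r -scalerBl enormZ.
have Pd : enorm (P s - P t) < d.
  by apply: le_lt_trans sd; apply: le_trans PP _; rewrite ler_wpM2l// lerDl.
rewrite FE.
have -> : g (P s) - g (P t) - dotv xi (P s - P t) =
    (g (P s) - g (P t) - dotv (grad g (P t)) (P s - P t)) +
    dotv (grad g (P t) - xi) (P s - P t) by rewrite !dotvDl dotvNl; ring.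
apply: le_trans (ler_normD _ _) _.
have h1 := hd _ Pd.
have h2 := le_trans (cauchy_schwarz _ _)
  (ler_wpM2r (enorm_ge0 (P s - P t)) (gradM t t01)).
apply: (@le_trans _ _ ((M + e') * (`|s - t| * enorm c))).
  apply: le_trans (lerD h1 h2) _.
  by rewrite addrC -mulrDl ler_wpM2l// addr_ge0// ltW.
rewrite mulrCA mulrC ler_wpM2r// mulrDl lerD2l /e' mulrAC ler_pdivrMr//.
by rewrite ler_wpM2l// ?lerDl// ltW.
Qed.

Lemma outside_halfspace rad Omega y N q : open Omega -> boundary Omega y ->
  inner_normal rad Omega y N -> dotv (q - y) N <= 0 -> ~ Omega q.
Proof.
move=> oO by_ HN qN Oq; have := HN.2 q (subset_closure Oq) => h.
have qy : q - y = 0.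
  apply: enorm_eq0; apply/eqP; rewrite -sqrf_eq0; apply/eqP/le_anti.
  by rewrite sqr_ge0 andbT; lra.
by move: Oq; rewrite -(subrK y q) qy add0r => /((boundary_open _ oO).1 by_).2.
Qed.

Lemma unit_orthogonal N : (1 < n)%N -> exists2 tau : 'rV[R]_n,
  enorm tau = 1 & dotv tau N = 0.
Proof.
move=> n1; pose i : 'I_n := Ordinal (ltnW n1); pose j : 'I_n := Ordinal n1.
have dd (k : 'I_n) x : dotv (delta_mx 0 k) x = x 0 k.
  rewrite /dotv (bigD1 k)//= big1 ?addr0 => [|l lk].
    by rewrite mxE !eqxx mul1r.
  by rewrite mxE eqxx (negbTE lk) mul0r.
suff [v v0 vN] : exists2 v : 'rV[R]_n, v != 0 & dotv v N = 0.
  exists ((enorm v)^-1 *: v); last by rewrite dotvZl vN mulr0.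
  rewrite enormZ ger0_norm ?invr_ge0 ?enorm_ge0// mulVf//.
  by rewrite gt_eqF// enorm_gt0.
have [Ni|Ni] := eqVneq (N 0 i) 0.
  exists (delta_mx 0 i); last by rewrite dd.
  apply/eqP => /rowP /(_ i); rewrite !mxE !eqxx => /eqP; by rewrite oner_eq0.
exists (N 0 j *: delta_mx 0 i - N 0 i *: delta_mx 0 j).
  apply/eqP => /rowP /(_ j); rewrite !mxE !eqxx /= mulr0 mulr1 sub0r => /eqP.
  by rewrite oppr_eq0 (negbTE Ni).
by rewrite dotvDl dotvNl !dotvZl !dd; ring.
Qed.

(** The points y and p are joined by a path in the boundary of length at most
    7 rho, where rho is the square root of l = 2 <p - y, N>, and which stays within
    4 rho of y; the mean value inequality along it then gives the error
    7 rho K (4 rho)^b.  The path is the projection of three segments,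
    y -> y + 3 rho tau -> p + 3 rho tau -> p, with tau a unit vector orthogonal to N
    that does not point inwards at p.  The first segment stays in the hyperplane
    supporting Omega at y, the last one in the half-space excluded at p, and the
    middle one is too far from y: on it <q - y, N> is at most <p - y, N>, so that
    any point q of the closure there would be within rho of y.
    Measuring the error by l rather than by |p - y| matters: in a thin domain two
    points that are close in space can be far apart along the boundary. *)
Lemma boundary_taylor rad Omega g (b K : R) y p N : (1 < n)%N ->
  bounded_domain Omega -> exterior_sphere rad Omega ->
  0 <= b <= 1 -> 0 <= K ->
  (forall q, boundary Omega q -> differentiable g q) ->
  (forall q, boundary Omega q -> 
     enorm (grad g q - grad g y) <= K * enorm (q - y) `^ b) ->
  boundary Omega y -> inner_normal rad Omega y N -> boundary Omega p ->
  `|g p - g y - dotv (grad g y) (p - y)| <=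
    28 * K * (2 * dotv (p - y) N) `^ ((1 + b) / 2).
Proof.
move=> n1 bd S /andP[b0 b1] K0 dg gK yb HN pb.
have [oO _ _ _] := bd.
have [Cy nOy] := (boundary_open _ oO).1 yb.
have [Cp nOp] := (boundary_open _ oO).1 pb.
have [Np HNp] := exterior_sphere_normal S pb.
set l := 2 * dotv (p - y) N.
have [->|py] := eqVneq p y.
  rewrite !subrr dotvC dotv0l subrr normr0.
  by rewrite !mulr_ge0 ?powR_ge0.
have pyl : enorm (p - y) ^+ 2 <= l := HN.2 p Cp.
have py0 : 0 < enorm (p - y) by rewrite enorm_gt0// subr_eq0.
have l0 : 0 < l by apply: lt_le_trans pyl; rewrite exprn_gt0.
pose rho := Num.sqrt l.
have rho0 : 0 < rho by rewrite sqrtr_gt0.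
have rho2 : rho ^+ 2 = l by rewrite sqr_sqrtr// ltW.
have pyr : enorm (p - y) <= rho.
  by rewrite -(@ler_pXn2r _ 2)// ?nnegrE ?enorm_ge0 ?(ltW rho0)// rho2.
have [tau tau1 [tauN tauNp]] : exists2 tau : 'rV[R]_n, enorm tau = 1 &
    dotv tau N = 0 /\ dotv tau Np <= 0.
  have [tau t1 tN] := unit_orthogonal N n1.
  have [h|/ltW h] := leP (dotv tau Np) 0; first by exists tau.
  by exists (- tau); rewrite ?enormN// !dotvNl tN oppr0 oppr_le0.
(* The factor 3 keeps the middle segment at distance at least 2 rho from y. *)
pose c := (3 * rho) *: tau.
have cn : enorm c = 3 * rho.
  by rewrite enormZ tau1 mulr1 ger0_norm// mulr_ge0// ltW.
have projy : proj Omega y = y := proj_closure_id bd S Cy.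
have projp : proj Omega p = p := proj_closure_id bd S Cp.
(* Projected points stay within 4 rho of y because y is its own projection. *)
pose M := K * (4 * rho) `^ b.
have gradM q : ~ Omega q -> enorm (q - y) <= 4 * rho ->
    enorm (grad g (proj Omega q) - grad g y) <= M.
  move=> nOq qy; apply: le_trans (gK _ (proj_boundary bd S nOq)) _.
  rewrite ler_wpM2l// ge0_ler_powR ?nnegrE ?enorm_ge0//.
    by rewrite mulr_ge0// ltW.
  by rewrite -{1}projy; apply: le_trans (proj_contract _ _ bd S) qy.
have tc t : 0 <= t <= 1 -> enorm (t *: c) <= 3 * rho.
  move=> /andP[t0 t1]; rewrite enormZ cn ger0_norm// ler_piMl//.
  by rewrite mulr_ge0// ltW.
have seg a v m : enorm v <= m ->
  (forall t, 0 <= t <= 1 -> ~ Omega (a + t *: v)) ->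
  (forall t, 0 <= t <= 1 -> enorm (a + t *: v - y) <= 4 * rho) ->
  `|(g (proj Omega (a + v)) - g (proj Omega a)) -
    dotv (grad g y) (proj Omega (a + v) - proj Omega a)| <= M * m.
  move=> vm out near.
  apply: le_trans (projected_segment bd S dg out _) _.
    by move=> t t01; apply: gradM; [exact: out|exact: near].
  by rewrite ler_wpM2l// mulr_ge0// powR_ge0.
have s1 : `|(g (proj Omega (y + c)) - g y) -
    dotv (grad g y) (proj Omega (y + c) - y)| <= M * (3 * rho).
  rewrite -{2 5}projy; apply: seg => [|t t01|t t01]; first by rewrite cn.
    apply: (outside_halfspace oO yb HN).
    by rewrite addrAC subrr add0r !dotvZl tauN !mulr0.
  by rewrite addrAC subrr add0r; have := tc t t01; lra.
have s2 : `|(g (proj Omega (p + c)) - g (proj Omega (y + c))) -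
    dotv (grad g y) (proj Omega (p + c) - proj Omega (y + c))| <= M * rho.
  have -> : p + c = (y + c) + (p - y) by rewrite [RHS]addrC addrA subrK.
  have E t : y + c + t *: (p - y) - y = c + t *: (p - y).
    by rewrite addrAC [y + c]addrC addrK.
  have tpy t : 0 <= t <= 1 -> enorm (t *: (p - y)) <= rho.
    move=> /andP[t0 t1]; rewrite enormZ ger0_norm//.
    by apply: le_trans pyr; rewrite ler_piMl// enorm_ge0.
  apply: seg => // t t01; last first.
    rewrite E; apply: le_trans (enormD _ _) _; rewrite cn.
    by have := tpy t t01; lra.
  move=> Oq; have := HN.2 _ (subset_closure Oq); rewrite E => h.
  have : enorm (c + t *: (p - y)) ^+ 2 <= rho ^+ 2.
    apply: le_trans h _; rewrite rho2 dotvDl !dotvZl tauN mulr0 add0r mulrCA.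
    by case/andP: t01 => t0 t1; rewrite ler_piMl// ltW.
  rewrite ler_pXn2r ?nnegrE ?enorm_ge0 ?(ltW rho0)// => h'.
  have := enormD (c + t *: (p - y)) (- (t *: (p - y))).
  by rewrite addrK cn enormN; have := tpy t t01; lra.
have s3 : `|(g (proj Omega (p + c)) - g p) -
    dotv (grad g y) (proj Omega (p + c) - p)| <= M * (3 * rho).
  rewrite -{2 4}projp; apply: seg => [|t t01|t t01]; first by rewrite cn.
    apply: (outside_halfspace oO pb HNp).
    rewrite addrAC subrr add0r !dotvZl; case/andP: t01 => t0 t1.
    by rewrite mulr_ge0_le0// mulr_ge0_le0// mulr_ge0// ltW.
  rewrite addrAC addrC; apply: le_trans (enormD _ _) _.
  by have := tc t t01; lra.
have -> : 28 * K * l `^ ((1 + b) / 2) = 28 * K * (rho * rho `^ b).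
  rewrite -rho2 -(powR_mulrn 2 (ltW rho0)) -powRrM mulrC.
  have -> : 2%:R * ((1 + b) / 2) = 1 + b :> R by field.
  by rewrite powRD ?(gt_eqF rho0) ?implybT// powRr1 ?ltW// mulrC.
have : M * (7 * rho) <= 28 * K * (rho * rho `^ b).
  rewrite /M (powRM _ (ler0n _ 4) (ltW rho0)).
  have : (4 : R) `^ b <= 4.
    by rewrite -[leRHS](@powRr1 R)// ler_powR//; lra.
  have := powR_ge0 rho b; move: (4 `^ b) (rho `^ b) => A B B0 A4.
  have : 0 <= (4 - A) * (K * B * 7 * rho).
    by rewrite !mulr_ge0 ?subr_ge0// ltW.
  lra.
move: s1 s2 s3; rewrite !ler_norml !dotvDr !dotvNr; lra.
Qed.

End BoundaryTaylor.

(** * Comparison and barriers *)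

Section Barrier.
Context {R : realType} {n : nat}.
Implicit Types (Omega : set 'rV[R]_n) (v : 'rV[R]_n -> R)
  (x y p q w xi N : 'rV[R]_n).

(** All that the barriers use of a subsolution of an equation with right-hand side
    at least -F: on the scalar matrix c I the operator is c S, where S is the sum of
    its coefficients.  Stated in this form it also holds for the opposite of a
    supersolution. *)
Definition scalar_subsol (S F : R) Omega v : Prop :=
  forall x, Omega x -> forall xi (c : R), superjet v x xi c%:M -> - F <= c * S.

Lemma usc_on_near (K : set 'rV[R]_n) v p (m : R) : usc_on K v ->
  K p -> v p < m -> \forall x \near p, K x -> v x < m.
Proof.
move=> usc Kp vm; have [|V nV hV] := usc p (- m); first by rewrite /= lte_fin ltrN2.
have : \forall x \near p, K x -> V x.
  by have : within K (nbhs p) V by rewrite (nbhs_subspace_in Kp).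
by apply: filterS => x hx Kx; have := hV _ (hx Kx); rewrite /= lte_fin ltrN2.
Qed.

(** phi has Hessian -2 c I, so that F < 2 c S makes it a strict supersolution: at an
    interior maximum of v - phi it would be a test function for v. *)
Lemma comparison Omega v (S F al c : R) y xi :
  bounded_domain Omega -> usc_on (closure Omega) v ->
  scalar_subsol S F Omega v -> F < 2 * c * S ->
  let phi x := al + dotv (x - y) xi - c * enorm (x - y) ^+ 2 in
  (forall p, boundary Omega p -> v p <= phi p) ->
  forall x, Omega x -> v x <= phi x.
Proof.
move=> [oO [a Oa] _ bO] usc sub cF phi bdle x Ox.
have [| |x0 Cx0 xmax] := @usc_attains_max R _ _ (fun w => v w - phi w)
    (bounded_closure_compact bO).
- by exists a; exact: subset_closure.
- move=> p m Kp pm.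
  pose e := (m - (v p - phi p)) / 2.
  have e0 : 0 < e by rewrite /e; lra.
  have vp : v p < v p + e by lra.
  have phic : phi q @[q --> p] --> phi p.
    exact: (cvgB (cvgD (cvg_cst al) (@dotv_continuous R n y xi p))
      (cvgM (cvg_cst c) (@sqr_enorm_continuous R n y p))).
  have lp : phi p - e < phi p by lra.
  have := usc_on_near usc Kp vp.
  have /cvgr_gt /(_ _ lp) := phic.
  apply: filterS2 => q hq hv Kq; have := hv Kq.
  have : 2 * e = m - (v p - phi p) by rewrite /e; field.
  by move: hq => /=; lra.
have [bd0|/(boundary_open _ oO) nbd] := pselect (boundary Omega x0).
  by have := xmax x (subset_closure Ox); have := bdle _ bd0; lra.
have Ox0 : Omega x0 by apply: contrapT => nO; apply: nbd.
suff : superjet v x0 (xi - (2 * c) *: (x0 - y)) (- (2 * c))%:M.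
  by move=> /(sub _ Ox0); lra.
split=> [|e e0]; first exact: tr_scalar_mx.
have nO : nbhs x0 Omega := open_nbhs_nbhs (conj oO Ox0).
apply: filterS nO => w Ow; rewrite /quad mul_mx_scalar.
have := xmax w (subset_closure Ow); rewrite /phi.
have -> : w - y = (w - x0) + (x0 - y) by rewrite addrA subrK.
have := mulr_ge0 (ltW e0) (sqr_ge0 (enorm (w - x0))).
move: (w - x0) (x0 - y) => A B; rewrite !enorm_sqr !dotvE (dotvC B A) (dotvC xi A); lra.
Qed.

(** The concave power l^s lies below an affine function of l, which up to a constant
    has the same value at l = d. *)
Lemma powR_interp (s l d : R) : 0 <= s <= 1 -> 0 <= l -> 0 < d ->
  l `^ s <= d `^ s * (1 + l / d).
Proof.
move=> /andP[s0 s1] l0 d0; have ld0 : 0 <= l / d by rewrite divr_ge0// ltW.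
have [ld|/ltW dl] := leP l d.
  apply: (@le_trans _ _ (d `^ s)).
    by apply: ge0_ler_powR; rewrite ?nnegrE// ltW.
  by rewrite ler_peMr ?powR_ge0// lerDl.
rewrite -[in leLHS](divfK (lt0r_neq0 d0) l) powRM ?(ltW d0)// mulrC.
rewrite ler_wpM2l ?powR_ge0//; apply: le_trans (ler1_powR _ s1) _.
  by rewrite ler_pdivlMr// mul1r.
by rewrite lerDr.
Qed.

(** The bound H l^s on the boundary data, with l = 2 <p - y, N>, is dominated by the
    affine function H d^s (1 + l / d); adding c (l - |p - y|^2), which is nonnegative
    on the closure, makes it a strict supersolution as soon as 2 c S > F.  The
    scale d = |x - y| is chosen after x, and l(x) <= 2 rad d. *)
Lemma barrier_estimate rad Omega v (S F H s : R) y x N xi :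
  0 < rad -> 0 < S -> 0 <= F -> 0 <= H -> 0 <= s <= 1 ->
  bounded_domain Omega -> usc_on (closure Omega) v ->
  scalar_subsol S F Omega v -> inner_normal rad Omega y N ->
  (forall p, boundary Omega p ->
     v p - v y <= dotv (p - y) xi + H * (2 * dotv (p - y) N) `^ s) ->
  Omega x -> boundary Omega y ->
  v x - v y <= dotv (x - y) xi +
    H * (1 + 2 * rad) * enorm (x - y) `^ s + rad / S * F * enorm (x - y).
Proof.
move=> rad0 S0 F0 H0 s01 bd usc sub HN hbd Ox yb.
have oO : open Omega by case: bd.
have d0 : 0 < enorm (x - y).
  exact: enorm_gt0 (inside_sub_boundary_neq0 oO Ox yb).
set d := enorm (x - y) in d0 *.
apply/ler_addgt0Pr => e e0.
(* The strict inequality F < 2 c S costs an arbitrarily small e at x. *)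
pose c := F / (2 * S) + e / (2 * rad * d).
have cF : F < 2 * c * S.
  have -> : 2 * c * S = F + e * S / (rad * d).
    by rewrite /c; field; rewrite !lt0r_neq0.
  by rewrite ltrDl divr_gt0// mulr_gt0.
have c0 : 0 <= c.
  by rewrite addr_ge0// divr_ge0 ?mulr_ge0// ltW.
set D := d `^ s; have D0 : 0 <= D by exact: powR_ge0.
have HD0 : 0 <= H * D / d + c.
  by rewrite addr_ge0// divr_ge0 ?mulr_ge0 ?(ltW d0).
have := @comparison Omega v S F (v y + H * D) c y
  (xi + (2 * (H * D / d + c)) *: N) bd usc sub cF _ x Ox.
have phiE q : v y + H * D + dotv (q - y) (xi + (2 * (H * D / d + c)) *: N) -
    c * enorm (q - y) ^+ 2 = v y + dotv (q - y) xi +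
    H * (D * (1 + 2 * dotv (q - y) N / d)) +
    c * (2 * dotv (q - y) N - enorm (q - y) ^+ 2).
  rewrite dotvDr dotvZr; move: (dotv (q - y) N) => ?; field; exact: lt0r_neq0.
rewrite phiE => h; apply: le_trans (_ : v y + dotv (x - y) xi +
    H * (D * (1 + 2 * dotv (x - y) N / d)) +
    c * (2 * dotv (x - y) N - enorm (x - y) ^+ 2) - v y <= _).
  rewrite lerD2r; apply: h => p pb; rewrite phiE.
  have Cp := ((boundary_open _ oO).1 pb).1.
  have l0 : 0 <= 2 * dotv (p - y) N by rewrite mulr_ge0// (inner_normal_ge0 HN).
  have h1 := hbd p pb.
  have h2 := ler_wpM2l H0 (powR_interp s01 l0 d0).
  have h3 : 0 <= c * (2 * dotv (p - y) N - enorm (p - y) ^+ 2).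
    by rewrite mulr_ge0// subr_ge0; exact: HN.2.
  by rewrite -/D in h2; lra.
have h1 : 2 * dotv (x - y) N / d <= 2 * rad.
  by rewrite ler_pdivrMr//; exact: inner_normal_le HN.
have h2 : H * (D * (1 + 2 * dotv (x - y) N / d)) <= H * (1 + 2 * rad) * D.
  by rewrite mulrA [leRHS]mulrAC ler_wpM2l ?mulr_ge0// lerD2l.
have h3 : c * (2 * dotv (x - y) N - enorm (x - y) ^+ 2) <= c * (2 * rad * d).
  rewrite ler_wpM2l//; have := inner_normal_le x HN; rewrite -/d.
  by have := sqr_ge0 d; lra.
have h4 : c * (2 * rad * d) = rad / S * F * d + e.
  by rewrite /c; field; rewrite !lt0r_neq0.
lra.
Qed.

Lemma ray_exit rad Omega y x N : open Omega ->
  inner_normal rad Omega y N -> Omega x -> boundary Omega y ->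
  exists2 t : R, 1 <= t & boundary Omega (y + t *: (x - y)).
Proof.
move=> oO HN Ox yb.
have xy := inside_sub_boundary_neq0 oO Ox yb.
have d0 := enorm_gt0 xy; set d := enorm _ in d0.
have r0 : 0 <= rad by rewrite -HN.1 enorm_ge0.
pose T := (2 * rad + 1) / d + 1.
have T0 : 0 <= (2 * rad + 1) / d by rewrite divr_ge0 ?ltW//; lra.
have nOc : ~ Omega (y + T *: (x - y)).
  move=> /subset_closure Cc; have := inner_normal_diam HN Cc.
  rewrite addrAC subrr add0r enormZ ger0_norm ?addr_ge0// -/d mulrDl divfK ?lt0r_neq0//.
  lra.
have [s /andP[s0 s1] sb] := segment_meets_boundary oO Ox nOc.
exists (1 + s * (T - 1)).
  by rewrite lerDl mulr_ge0 ?(ltW s0)// /T addrK.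
rewrite (_ : y + _ = x + s *: (y + T *: (x - y) - x))//.
by apply/rowP => i; rewrite !mxE; ring.
Qed.

(** The Taylor inequality at the point y + t (x - y), t >= 1, where the ray leaves
    Omega, bounds t <x - y, xi>; dividing by t keeps the bound because t^s <= t.
    The boundary values thus control xi in every direction that points into
    Omega, including the normal one. *)
Lemma slope_bound rad Omega (v : 'rV[R]_n -> R) (G H s : R) y x N xi :
  0 <= H -> 0 <= s <= 1 -> open Omega ->
  inner_normal rad Omega y N -> Omega x -> boundary Omega y ->
  (forall p, boundary Omega p -> v p - v y <= G * enorm (p - y)) ->
  (forall p, boundary Omega p ->
     dotv (p - y) xi <= v p - v y + H * (2 * dotv (p - y) N) `^ s) ->
  dotv (x - y) xi <= G * enorm (x - y) + H * (2 * rad * enorm (x - y)) `^ s.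
Proof.
move=> H0 /andP[s0 s1] oO HN Ox yb hG hT.
have [t t1 tb] := ray_exit oO HN Ox yb.
have t0 : 0 < t by lra.
have lx0 : 0 <= 2 * dotv (x - y) N.
  by rewrite mulr_ge0// (inner_normal_ge0 HN)//; exact: subset_closure.
have := le_trans (hT _ tb) (lerD (hG _ tb) (lexx _)).
rewrite addrAC subrr add0r enormZ (ger0_norm (ltW t0)) !dotvZl (mulrCA 2 t).
rewrite (powRM _ (ltW t0) lx0) => h.
have h1 : t `^ s * (2 * dotv (x - y) N) `^ s <=
    t * (2 * rad * enorm (x - y)) `^ s.
  apply: ler_pM; rewrite ?powR_ge0 ?ler1_powR//.
  apply: ge0_ler_powR => //; rewrite ?nnegrE//.
    exact: le_trans lx0 (inner_normal_le x HN).
  exact: inner_normal_le HN.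
rewrite -(ler_pM2l t0); apply: le_trans h _.
by have := ler_wpM2l H0 h1; lra.
Qed.

End Barrier.

(** * Null sets and the essential bound on the right-hand side *)

Section NullSets.
Context {R : realType}.

(** If every slice t in [a, b] had sum at least V, integrating over t and exchanging
    sum and integral would give total at least V (b - a). *)
Lemma light_slice (c lo hi : nat -> R) (a b V : R) :
  (forall k, 0 <= c k) -> (forall k, lo k <= hi k) -> a < b -> 0 <= V ->
  (\sum_(0 <= k <oo) (c k * (hi k - lo k))%:E < (V * (b - a))%:E)%E ->
  exists2 t, a <= t <= b &
    (\sum_(0 <= k <oo) (c k * (lo k <= t <= hi k)%R%:R)%:E < V%:E)%E.
Proof.
move=> c0 lohi ab V0 small; apply: contrapT => none.
pose D : set R := `[a, b]%classic.
have mD : measurable D by exact: measurable_itv.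
pose mu := @lebesgue_measure R.
have muitv (x y : R) : x <= y -> mu `[x, y]%classic = (y - x)%:E.
  move=> xy; rewrite /mu lebesgue_measure_itv /= lte_fin.
  by case: ltgtP xy => // -> _; rewrite subrr.
pose f k (t : R) := ((c k)%:E * (\1_(`[lo k, hi k]%classic) t)%:E)%E.
have fE k t : f k t = (c k * (lo k <= t <= hi k)%R%:R)%:E.
  rewrite /f -EFinM indicE; congr (_ * _%:R)%:E.
  by congr nat_of_bool; apply/idP/idP; rewrite inE /= in_itv.
have mI k : measurable_fun D (EFin \o (\1_(`[lo k, hi k]%classic) : R -> R)).
  by apply/measurable_EFinP; exact: measurable_indic.
have f0 k t : D t -> (0 <= f k t)%E by move=> _; rewrite fE lee_fin mulr_ge0.
have mf k : measurable_fun D (f k) by exact: (measurable_funeM _ (mI k)).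
have : (\int[mu]_(t in D) cst V%:E t <=
        \int[mu]_(t in D) \sum_(0 <= k <oo) f k t)%E.
  apply: ge0_le_integral => //.
    apply: (ge0_emeasurable_sum (P := xpredT)) => [k t Dt _|k _]; first exact: f0.
    exact: mf.
  move=> t Dt; rewrite leNgt; apply/negP => lt; apply: none; exists t => //.
  by apply: le_lt_trans lt; under eq_eseriesr do rewrite -fE.
have muD : mu D = (b - a)%:E := muitv _ _ (ltW ab).
rewrite integral_nneseries// (integral_cst mu mD) => h.
suff : (V%:E * (b - a)%:E < V%:E * (b - a)%:E)%E by rewrite ltxx.
rewrite -{1}muD; apply: le_lt_trans h _; rewrite -EFinM; apply: le_lt_trans small.
apply: lee_nneseries => k *; first by apply: integral_ge0 => t; exact: f0.
rewrite /f (ge0_integralZl mu mD (mI k)) ?lee_fin//; last first.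
  by move=> t _ /=; rewrite lee_fin.
rewrite integral_indic// EFinM lee_wpmul2l ?lee_fin// -(muitv _ _ (lohi k)).
by apply: le_measure; rewrite ?inE//; exact: measurableI.
Qed.

(** Boxes of total volume smaller than that of a box q miss a point of q.  The
    coordinates of the point are fixed one at a time, each choice replacing an edge
    length of the k-th box by the indicator of its edge; the weights w carry the
    indicators already produced. *)
Lemma exists_light_point (I : eqType) (s : seq I) (lo hi : nat -> I -> R)
    (qlo qhi : I -> R) (w : nat -> R) :
  uniq s -> (forall k i, lo k i <= hi k i) -> (forall i, qlo i < qhi i) ->
  (forall k, 0 <= w k) ->
  (\sum_(0 <= k <oo) (w k * \prod_(i <- s) (hi k i - lo k i))%:E <
     (\prod_(i <- s) (qhi i - qlo i))%:E)%E ->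
  exists2 x : I -> R, forall i, i \in s -> qlo i <= x i <= qhi i &
    (\sum_(0 <= k <oo)
       (w k * \prod_(i <- s) (lo k i <= x i <= hi k i)%R%:R)%:E < 1%:E)%E.
Proof.
move=> + lohi qq; elim: s w => [|j s IH] w /=.
  move=> _ w0; rewrite big_nil => h; exists qlo => //.
  apply: le_lt_trans h; under eq_eseriesr do rewrite big_nil.
  by under [leRHS]eq_eseriesr do rewrite big_nil.
move=> /andP[js us] w0 small.
have len0 k : 0 <= \prod_(i <- s) (hi k i - lo k i).
  by apply: prodr_ge0 => i _; rewrite subr_ge0.
have V0 : 0 <= \prod_(i <- s) (qhi i - qlo i).
  by apply: prodr_ge0 => i _; rewrite subr_ge0 ltW.
have [|t tq ht] := @light_slice
    (fun k => w k * \prod_(i <- s) (hi k i - lo k i))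
    (lo ^~ j) (hi ^~ j) (qlo j) (qhi j) _
    (fun k => mulr_ge0 (w0 k) (len0 k)) (lohi ^~ j) (qq j) V0.
  rewrite big_cons mulrC in small; apply: le_lt_trans small.
  under [leRHS]eq_eseriesr do rewrite big_cons mulrCA mulrC.
  exact: lexx.
have [| |x xq hx] := IH (fun k => w k * (lo k j <= t <= hi k j)%R%:R) us.
- by move=> k; rewrite mulr_ge0.
- by under eq_eseriesr do rewrite mulrAC.
exists (fun i => if i == j then t else x i).
  by move=> i; rewrite inE; case: eqP => [-> _|_ /= /xq].
apply: le_lt_trans hx; under eq_eseriesr => k _.
  rewrite big_cons eqxx mulrA.
  under eq_big_seq => i iS.
    rewrite (_ : (i == j) = false); last by apply: contraNF js => /eqP <-.
    over.
  over.
by [].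
Qed.

Lemma open_not_null n (A U : set 'rV[R]_n) : open U -> U !=set0 -> U `<=` A ->
  ~ lebesgue_null A.
Proof.
move=> oU [p Up] UA null.
have /nbhs_normP[r /= r0 hr] := open_nbhs_nbhs (conj oU Up).
pose q := r / 2; have q0 : 0 < q by rewrite divr_gt0.
pose V : R := \prod_(i <- index_enum 'I_n) (p 0 i + q - (p 0 i - q)).
have V0 : 0 < V by apply: prodr_gt0 => i _; lra.
have [lo [hi [lohi cover small]]] := null (V / 2) (divr_gt0 V0 (ltr0n _ 2)).
have [| | |x xq hx] := @exists_light_point _ (index_enum 'I_n)
  (fun k i => lo k 0 i) (fun k i => hi k 0 i)
  (fun i => p 0 i - q) (fun i => p 0 i + q) (fun=> 1) (index_enum_uniq _) lohi.
- by move=> i; lra.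
- by [].
- under eq_eseriesr do rewrite mul1r.
  apply: le_lt_trans small _; rewrite lte_fin -/V; lra.
have Ax : A (\row_i x i).
  apply/UA/hr => /=; apply: (@le_lt_trans _ _ q); last by rewrite /q; lra.
  rewrite /Num.norm /= mx_normrE; apply: bigmax_le => [|[i j] _ /=]; first exact: ltW.
  have := xq j (mem_index_enum j); rewrite (ord1 i) !mxE ler_norml; lra.
have [k _ hk] := cover _ Ax.
move: hx; apply/negP; rewrite -leNgt.
apply: le_trans (nneseries_lim_ge k.+1 _); last first.
  by move=> *; rewrite lee_fin mul1r prodr_ge0.
rewrite big_nat_recr//= -[leLHS]add0e leeD//.
  by apply: sume_ge0 => i _; rewrite lee_fin mul1r prodr_ge0.
rewrite mul1r big1 ?lexx// => i _; have := hk i; rewrite mxE => -> //.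
Qed.

End NullSets.

Section Linfty.
Context {R : realType} {n : nat}.
Implicit Types (Omega : set 'rV[R]_n) (f h : 'rV[R]_n -> R).

Lemma Linfty_norm_ge0 Omega h : (0 <= Linfty_norm Omega h)%E.
Proof.
by apply: le_ereal_inf_tmp => _ [M [M0 _] <-]; rewrite lee_fin.
Qed.

(** The set where |h| exceeds M contains a neighbourhood of each of its points, so
    it is empty when it is null. *)
Lemma Linfty_norm_bound Omega h (F : R) : open Omega ->
  (forall x M, Omega x -> 0 <= M -> M < `|h x| ->
     \forall z \near x, M < `|h z|) ->
  Linfty_norm Omega h = F%:E -> forall x, Omega x -> `|h x| <= F.
Proof.
move=> oO lsc LF x Ox; rewrite leNgt; apply/negP => Fh.
have : (Linfty_norm Omega h < `|h x|%:E)%E by rewrite LF lte_fin.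
move=> /ereal_inf_lt[_ [M [M0 null] <-]]; rewrite lte_fin => Mh.
have nb := lsc x M Ox M0 Mh.
apply: (@open_not_null R n _ ([set z | M < `|h z|]° `&` Omega)) null.
- by apply: openI => //; exact: open_interior.
- by exists x.
- by move=> z [/interior_subset hz Oz].
Qed.

Lemma near_continuous Omega f x : open Omega -> {within Omega, continuous f} ->
  Omega x -> {for x, continuous f}.
Proof.
by move=> oO; rewrite continuous_open_subspace// => fc Ox; apply: fc; rewrite inE.
Qed.

Lemma Linfty_norm_funrneg Omega f (F : R) : open Omega ->
  {within Omega, continuous f} -> Linfty_norm Omega (f^\-)%R = F%:E ->
  forall x, Omega x -> - F <= f x.
Proof.
move=> oO fc LF x Ox.
have h (z : 'rV[R]_n) : - f z <= `|(f^\-)%R z|.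
  by apply: le_trans (ler_norm _); rewrite /funrneg le_max lexx.
have : `|(f^\-)%R x| <= F.
  apply: Linfty_norm_bound LF x Ox => // y M Oy M0.
  rewrite ger0_norm ?funrneg_ge0// /funrneg lt_max [M < 0]ltNge M0 orbF ltrNr.
  move=> fM; have /cvgr_lt /(_ _ fM) := near_continuous oO fc Oy.
  apply: filterS => z fz; apply: lt_le_trans (h z); rewrite ltrNr//.
by have := h x; lra.
Qed.

Lemma Linfty_norm_funrpos Omega f (F : R) : open Omega ->
  {within Omega, continuous f} -> Linfty_norm Omega (f^\+)%R = F%:E ->
  forall x, Omega x -> f x <= F.
Proof.
move=> oO fc LF x Ox.
have h (z : 'rV[R]_n) : f z <= `|(f^\+)%R z|.
  by apply: le_trans (ler_norm _); rewrite /funrpos le_max lexx.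
have : `|(f^\+)%R x| <= F.
  apply: Linfty_norm_bound LF x Ox => // y M Oy M0.
  rewrite ger0_norm ?funrpos_ge0// /funrpos lt_max [M < 0]ltNge M0 orbF.
  move=> fM; have /cvgr_gt /(_ _ fM) := near_continuous oO fc Oy.
  by apply: filterS => z fz; apply: lt_le_trans (h z).
by have := h x; lra.
Qed.

(** * The operator on scalar matrices *)

(** The eigenvalues are read off from the factorization of the characteristic
    polynomial, unique up to permutation. *)
Lemma eigvals_scalar (c : R) i : (i < n)%N -> (eigvals (c%:M : 'M[R]_n))`_i = c.
Proof.
move=> ltin; have [_] := eigvalsP (tr_scalar_mx n c).
rewrite char_poly_trig ?scalar_mx_is_trig//.
have -> : \prod_(j < n) ('X - ((c%:M : 'M[R]_n) j j)%:P) =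
    \prod_(d <- nseq n c) ('X - d%:P).
  rewrite big_nseq -big_const_ord; apply: eq_bigr => j _.
  by rewrite mxE eqxx mulr1n.
move=> /prod_XsubC_eq; rewrite perm_sym => pl.
have : (eigvals (c%:M : 'M[R]_n))`_i \in nseq n c.
  by rewrite -(perm_mem pl) mem_nth// (perm_size pl) size_nseq.
by rewrite mem_nseq => /andP[_ /eqP].
Qed.

Lemma Mop_scalar (a : 'I_n -> R) (c : R) : Mop a c%:M = c * \sum_i a i.
Proof.
by rewrite /Mop mulr_sumr; apply: eq_bigr => i _; rewrite eigvals_scalar// mulrC.
Qed.

End Linfty.

(** * Estimates at a boundary point *)

Section Estimates.
Context {R : realType} {n : nat}.
Implicit Types (Omega : set 'rV[R]_n) (u v f g : 'rV[R]_n -> R)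
  (a : 'I_n -> R) (x y p q xi : 'rV[R]_n).

Lemma subsol_scalar a Omega f u (F : R) : visc_subsol a Omega f u ->
  (forall x, Omega x -> - F <= f x) -> scalar_subsol (\sum_i a i) F Omega u.
Proof.
move=> [_ sub] fF x Ox xi c /(sub x Ox); rewrite Mop_scalar.
exact: le_trans (fF x Ox).
Qed.

Lemma supersol_scalar a Omega f u (F : R) : visc_supersol a Omega f u ->
  (forall x, Omega x -> f x <= F) ->
  scalar_subsol (\sum_i a i) F Omega (\- u).
Proof.
move=> [_ super] fF x Ox xi c [_ jet].
have := super x Ox (- xi) (- c)%:M; rewrite Mop_scalar => h.
suff /h/le_trans/(_ (fF x Ox)) : subjet u x (- xi) (- c)%:M by lra.
split=> [|e e0]; first exact: tr_scalar_mx.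
apply: filterS (jet e e0) => z; rewrite /quad !mul_mx_scalar !dotvNl !dotvZl /=.
lra.
Qed.

Lemma continuous_usc_on (K : set 'rV[R]_n) u :
  {within K, continuous u} -> usc_on K u.
Proof.
move=> uc x m; rewrite /= lte_fin ltrNr => um.
exists [set z | u z < - m].
  by have /cvgr_lt /(_ _ um) := uc x.
by move=> z /=; rewrite lte_fin ltrNr.
Qed.

Lemma lsc_usc_opp (K : set 'rV[R]_n) u : lsc_on K u -> usc_on K (\- u).
Proof.
by rewrite /usc_on (_ : \- (\- u) = u)//; apply/funext => x /=; rewrite opprK.
Qed.

Lemma holder_semi_ge0 (W : zmodType) (nrm : W -> R) (b : R) (D : set 'rV[R]_n)
    (h : 'rV[R]_n -> W) p q :
  (forall w, 0 <= nrm w) -> D p -> D q -> p != q ->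
  (0 <= holder_semi nrm b D h)%E.
Proof.
move=> nrm0 Dp Dq pq; apply: le_ereal_sup_tmp.
exists (nrm (h p - h q) / enorm (p - q) `^ b)%:E; first by exists (p, q).
by rewrite lee_fin divr_ge0// powR_ge0.
Qed.

Lemma holder_semi_bound (W : zmodType) (nrm : W -> R) (b G : R)
    (D : set 'rV[R]_n) (h : 'rV[R]_n -> W) p q :
  holder_semi nrm b D h = G%:E -> D p -> D q -> p != q ->
  nrm (h p - h q) <= G * enorm (p - q) `^ b.
Proof.
move=> hG Dp Dq pq.
rewrite -ler_pdivrMr ?powR_gt0 ?enorm_gt0 ?subr_eq0//.
rewrite -lee_fin -hG; apply: ereal_sup_ubound; by exists (p, q).
Qed.

(** On a set of diameter 2 rad higher powers of the distance are absorbed into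
    lower ones. *)
Lemma diam_powR rad (s d : R) : 0 < d <= 2 * rad -> 0 <= s <= 1 ->
  d <= (2 * rad) `^ (1 - s) * d `^ s.
Proof.
move=> /andP[d0 dR] /andP[s0 s1].
have dE : d = d `^ (1 - s) * d `^ s.
  by rewrite -powRD ?(gt_eqF d0) ?implybT// subrK powRr1// ltW.
rewrite {1}dE ler_wpM2r ?powR_ge0// ge0_ler_powR ?nnegrE ?subr_ge0// ?(ltW d0)//.
lra.
Qed.

(** Here |p - y|^b is at most l^(b/2), so the barrier applies with exponent b/2 and
    no linear part. *)
Lemma boundary_estimate_holder rad Omega v (b S F G : R) x y :
  0 < rad -> 0 < b <= 1 -> 0 < S -> 0 <= F -> 0 <= G ->
  bounded_domain Omega -> exterior_sphere rad Omega ->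
  usc_on (closure Omega) v -> scalar_subsol S F Omega v ->
  Omega x -> boundary Omega y ->
  (forall p, boundary Omega p -> v p - v y <= G * enorm (p - y) `^ b) ->
  v x - v y <= (1 + 2 * rad + rad / S * (2 * rad) `^ (1 - b / 2)) *
    (G + F) * enorm (x - y) `^ (b / 2).
Proof.
move=> rad0 /andP[b0 b1] S0 F0 G0 bd sph usc sub Ox yb hG.
have [oO _ _ _] := bd.
have [N HN] := exterior_sphere_normal sph yb.
have s01 : 0 <= b / 2 <= 1 by lra.
have xy := inside_sub_boundary_neq0 oO Ox yb.
have dR : 0 < enorm (x - y) <= 2 * rad.
  by rewrite enorm_gt0//= (inner_normal_diam HN)//; exact: subset_closure.
have h : forall p, boundary Omega p ->
    v p - v y <= dotv (p - y) 0 + G * (2 * dotv (p - y) N) `^ (b / 2).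
  move=> p pb; rewrite dotvC dotv0l add0r.
  apply: le_trans (hG p pb) _; rewrite ler_wpM2l//.
  have Cp := ((boundary_open _ oO).1 pb).1.
  rewrite -[enorm _]ger0_norm ?enorm_ge0// -sqrtr_sqr -powR12_sqrt ?sqr_ge0//.
  rewrite -powRrM mulrC; apply: ge0_ler_powR; rewrite ?nnegrE ?sqr_ge0//; first by lra.
    by rewrite mulr_ge0// (inner_normal_ge0 HN).
  exact: HN.2.
have := barrier_estimate rad0 S0 F0 G0 s01 bd usc sub HN h Ox yb.
rewrite dotvC dotv0l add0r => H; apply: le_trans H _.
have := diam_powR dR s01.
have T0 := powR_ge0 (2 * rad) (1 - b / 2).
have E0 := powR_ge0 (enorm (x - y)) (b / 2).
move: T0 E0; set T := (2 * rad) `^ _; set E := _ `^ (b / 2) => T0 E0 dTE.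
have rS0 : 0 <= rad / S by rewrite divr_ge0 ?(ltW rad0) ?(ltW S0).
move: (rad / S) rS0 => P rS0.
have h1 : P * F * enorm (x - y) <= P * F * (T * E).
  by rewrite ler_wpM2l// mulr_ge0.
have h2 : 0 <= P * T * G * E by rewrite !mulr_ge0.
have h3 : 0 <= (1 + 2 * rad) * F * E by rewrite !mulr_ge0//; lra.
lra.
Qed.

(** The first term collects the contributions that are linear in the distance, the
    second one those of the Taylor remainder. *)
Definition C1_const (rad S b : R) : R :=
  (2 * rad) `^ (1 - (1 + b) / 2) * (1 + (1 + 2 * rad) / (2 * rad) + rad / S) +
  28 * ((2 * rad) `^ ((1 + b) / 2) + (1 + 2 * rad)).

(** The sign sg treats at once a subsolution, with sg = 1, and the opposite of a
    supersolution, with sg = -1.  In dimension at least 2 the barrier has the linear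
    part given by the gradient of g at y, with the Taylor remainder as modulus.  In
    dimension 1 nothing is orthogonal to N and the boundary is disconnected, but
    there l = 2 rad |p - y|, so that the Lipschitz bound alone is affine in l. *)
Lemma boundary_estimate_C1 rad Omega v g (sg b S F G K : R) x y :
  0 < rad -> 0 <= b < 1 -> 0 < S -> 0 <= F -> 0 <= G -> 0 <= K -> (0 < n)%N ->
  bounded_domain Omega -> exterior_sphere rad Omega ->
  usc_on (closure Omega) v -> scalar_subsol S F Omega v ->
  Omega x -> boundary Omega y -> `|sg| = 1 ->
  (forall p, boundary Omega p -> v p = sg * g p) ->
  (forall p, boundary Omega p -> differentiable g p) ->
  (forall p, boundary Omega p -> `|g p - g y| <= G * enorm (p - y)) ->
  (forall p, boundary Omega p ->
     enorm (grad g p - grad g y) <= K * enorm (p - y) `^ b) ->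
  v x - v y <=
    C1_const rad S b * (G + K + F) * enorm (x - y) `^ ((1 + b) / 2).
Proof.
move=> rad0 /andP[b0 b1] S0 F0 G0 K0 n0 bd sph usc sub Ox yb sg1 vg dg hG hK.
have [oO _ _ _] := bd.
have [N HN] := exterior_sphere_normal sph yb.
pose s := (1 + b) / 2; have s01 : 0 <= s <= 1 by rewrite /s; lra.
have xy := inside_sub_boundary_neq0 oO Ox yb.
have dR : 0 < enorm (x - y) <= 2 * rad.
  by rewrite enorm_gt0//= (inner_normal_diam HN)//; exact: subset_closure.
have hv p : boundary Omega p -> v p - v y <= G * enorm (p - y).
  move=> pb; rewrite !vg// -mulrBr; apply: le_trans (ler_norm _) _.
  by rewrite normrM sg1 mul1r hG.
have dTE := diam_powR dR s01; rewrite /C1_const -/s.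
have T0 := powR_ge0 (2 * rad) (1 - s).
have T'0 := powR_ge0 (2 * rad) s.
have E0 := powR_ge0 (enorm (x - y)) s.
have rS0 : 0 <= rad / S by rewrite divr_ge0 ?(ltW rad0) ?(ltW S0).
have r20 : 0 < 2 * rad by lra.
have q0 : 0 <= (1 + 2 * rad) / (2 * rad) by rewrite divr_ge0; lra.
have [n1|n1] := leqP n 1.
  have n_eq : n = 1%N by apply/anti_leq; rewrite n1 n0.
  have h p : boundary Omega p -> v p - v y <=
      dotv (p - y) 0 + G / (2 * rad) * (2 * dotv (p - y) N) `^ 1.
    move=> pb; rewrite dotvC dotv0l add0r; apply: le_trans (hv p pb) _.
    have Cp := ((boundary_open _ oO).1 pb).1.
    have l0 := inner_normal_ge0 HN Cp.
    rewrite powRr1 ?mulr_ge0//.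
    have <- : enorm (p - y) * enorm N = dotv (p - y) N.
      rewrite -[RHS]ger0_norm//; clear -n_eq.
      move: (p - y) N; rewrite n_eq => A B.
      by rewrite /enorm /dotv !big_ord1 -!expr2 !sqrtr_sqr normrM.
    rewrite HN.1 (_ : _ * _ = G * enorm (p - y))//.
    by field; rewrite lt0r_neq0.
  have := barrier_estimate rad0 S0 F0 (divr_ge0 G0 (ltW r20)) _ bd usc sub HN h Ox yb.
  rewrite ler01 lexx dotvC dotv0l add0r powRr1 ?enorm_ge0// => /(_ isT) H.
  apply: le_trans H _.
  move: T0 T'0 E0 dTE; set T := _ `^ (1 - s); set T' := (2 * rad) `^ s.
  set E := _ `^ s => T0 T'0 E0 dTE.
  have -> : G / (2 * rad) * (1 + 2 * rad) = G * ((1 + 2 * rad) / (2 * rad)).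
    by rewrite mulrAC mulrA.
  move: ((1 + 2 * rad) / (2 * rad)) (rad / S) q0 rS0 => Q P q0 rS0.
  have h1 : 0 <= (G * Q + P * F) * (T * E - enorm (x - y)).
    by rewrite mulr_ge0 ?subr_ge0// addr_ge0 ?mulr_ge0.
  have h2 : 0 <= 28 * (T' + (1 + 2 * rad)) * (G + K + F) * E.
    by rewrite !mulr_ge0 ?addr_ge0// ltW.
  have h3 : 0 <= T * (G + (1 + Q + P) * K + F + P * G + Q * F) * E.
    by rewrite !mulr_ge0 ?addr_ge0 ?mulr_ge0 ?addr_ge0.
  lra.
have b01 : 0 <= b <= 1 by lra.
pose xi := sg *: grad g y.
have taylor p : boundary Omega p -> `|v p - v y - dotv (p - y) xi| <=
    28 * K * (2 * dotv (p - y) N) `^ s.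
  move=> pb; rewrite !vg// dotvZr -mulrBr -mulrBr normrM sg1 mul1r dotvC.
  exact: boundary_taylor n1 bd sph b01 K0 dg hK yb HN pb.
have H0 : 0 <= 28 * K by rewrite mulr_ge0.
have hb p : boundary Omega p -> v p - v y <=
    dotv (p - y) xi + 28 * K * (2 * dotv (p - y) N) `^ s.
  by move=> /taylor; rewrite ler_norml; lra.
have hs p : boundary Omega p -> dotv (p - y) xi <=
    v p - v y + 28 * K * (2 * dotv (p - y) N) `^ s.
  by move=> /taylor; rewrite ler_norml; lra.
have := barrier_estimate rad0 S0 F0 H0 s01 bd usc sub HN hb Ox yb.
have := slope_bound H0 s01 oO HN Ox yb hv hs.
rewrite powRM ?(ltW r20) ?enorm_ge0//.
move: T0 T'0 E0 dTE; set T := _ `^ (1 - s); set T' := (2 * rad) `^ s.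
set E := _ `^ s => T0 T'0 E0 dTE.
move: ((1 + 2 * rad) / (2 * rad)) (rad / S) q0 rS0 => Q P q0 rS0.
have h1 : 0 <= (G + P * F) * (T * E - enorm (x - y)).
  by rewrite mulr_ge0 ?subr_ge0// addr_ge0 ?mulr_ge0.
have h2 : 0 <= 28 * (T' + (1 + 2 * rad)) * (G + F) * E.
  by rewrite !mulr_ge0 ?addr_ge0// ltW.
have h3 : 0 <= T * ((1 + Q + P) * K + F + Q * F + P * G + Q * G) * E.
  by rewrite !mulr_ge0 ?addr_ge0 ?mulr_ge0 ?addr_ge0.
lra.
Qed.

End Estimates.

(** * Passing to seminorms *)

Section Assembly.
Context {R : realType} {n : nat}.
Implicit Types (Omega : set 'rV[R]_n) (u v f g : 'rV[R]_n -> R)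
  (a : 'I_n -> R) (x y p q xi : 'rV[R]_n).

(** The seminorms and the essential supremum may be infinite; being nonnegative,
    their sum is then +oo and the estimate holds. *)
Lemma lee_finite_bound (C r : R) (X : \bar R) : 0 < C -> (0 <= X)%E ->
  (forall t, X = t%:E -> r <= C * t) -> (r%:E <= C%:E * X)%E.
Proof.
move=> C0; case: X => [t||//] X0 h; last by rewrite gt0_muley ?lte_fin// leey.
by rewrite -EFinM lee_fin h.
Qed.

Lemma nneg_adde_finite (X Y : \bar R) (t : R) : (0 <= X)%E -> (0 <= Y)%E ->
  (X + Y = t%:E)%E -> exists b c : R,
    [/\ X = b%:E, Y = c%:E, 0 <= b, 0 <= c & t = b + c].
Proof.
case: X => [b||] //; case: Y => [c||] //; rewrite ?lee_fin => b0 c0 // [<-].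
by exists b, c.
Qed.

(** Without two distinct boundary points the seminorms would be suprema of the empty
    set, that is -oo. *)
Lemma second_boundary_point rad Omega x y : open Omega ->
  exterior_sphere rad Omega -> Omega x -> boundary Omega y ->
  exists2 p, boundary Omega p & p != y.
Proof.
move=> oO sph Ox yb; have [N HN] := exterior_sphere_normal sph yb.
have [t t1 pb] := ray_exit oO HN Ox yb; exists (y + t *: (x - y)) => //.
rewrite -subr_eq0 addrAC subrr add0r scaler_eq0 negb_or gt_eqF ?(lt_le_trans ltr01)//=.
exact: inside_sub_boundary_neq0 oO Ox yb.
Qed.

Definition holder_const (rad S b : R) : R :=
  1 + 2 * rad + rad / S * (2 * rad) `^ (1 - b / 2).

Lemma holder_const_gt0 (rad S b : R) : 0 < rad -> 0 <= S -> 0 < holder_const rad S b.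
Proof.
move=> r0 S0; rewrite ltr_wpDr ?addr_gt0 ?mulr_gt0// mulr_ge0 ?powR_ge0//.
by rewrite divr_ge0// ltW.
Qed.

Lemma C1_const_gt0 (rad S b : R) : 0 < rad -> 0 <= S -> 0 < C1_const rad S b.
Proof.
move=> r0 S0; rewrite ltr_wpDl//.
  rewrite mulr_ge0 ?powR_ge0// !addr_ge0//; first by rewrite divr_ge0; lra.
  by rewrite divr_ge0// ltW.
rewrite mulr_gt0// ltr_wpDl ?powR_ge0//; lra.
Qed.

Lemma sum_coef a (atilde : R) : in_Abar a -> mean_coef a = atilde ->
  0 < \sum_i a i /\ \sum_i a i = `|n%:R * atilde|.
Proof.
move=> [a0 [j aj]] am.
have n0 : n%:R != 0 :> R by rewrite pnatr_eq0 -lt0n (leq_trans _ (ltn_ord j)).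
have S0 : 0 < \sum_i a i.
  by rewrite (bigD1 j)//= ltr_pwDl// sumr_ge0.
by rewrite -am /mean_coef mulrC divfK// gtr0_norm.
Qed.

Lemma quotient_bound_holder rad Omega v g (sg b S : R) (L : \bar R) :
  0 < rad -> 0 < b <= 1 -> 0 < S -> (0 <= L)%E ->
  bounded_domain Omega -> exterior_sphere rad Omega ->
  usc_on (closure Omega) v ->
  (forall F, L = F%:E -> scalar_subsol S F Omega v) -> `|sg| = 1 ->
  (forall p, boundary Omega p -> v p = sg * g p) ->
  forall x y, Omega x -> boundary Omega y ->
  (((v x - v y) / enorm (x - y) `^ (b / 2))%:E <= (holder_const rad S b)%:E *
    (holder_semi Num.norm b (boundary Omega) g + L))%E.
Proof.
move=> rad0 b01 S0 L0 bd sph usc sub sg1 vg x y Ox yb.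
have [oO _ _ _] := bd.
have [p pb py] := second_boundary_point oO sph Ox yb.
have G0 := @holder_semi_ge0 R n _ Num.norm b _ g p y (fun w : R => normr_ge0 w) pb yb py.
apply: lee_finite_bound; [exact/holder_const_gt0/ltW|exact: adde_ge0|].
move=> t /(nneg_adde_finite G0 L0)[G [F [GE FE G0' F0 ->]]].
rewrite ler_pdivrMr ?powR_gt0 ?enorm_gt0 ?(inside_sub_boundary_neq0 oO Ox yb)//.
apply: (boundary_estimate_holder rad0 b01 S0 F0 G0' bd sph usc (sub F FE) Ox yb).
move=> q qb; rewrite !vg// -mulrBr; apply: le_trans (ler_norm _) _.
rewrite normrM sg1 mul1r.
have [->|qy] := eqVneq q y; first by rewrite !subrr normr0 mulr_ge0 ?powR_ge0.
exact: holder_semi_bound GE qb yb qy.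
Qed.

Lemma quotient_bound_C1 rad Omega v g (sg b S : R) (L : \bar R) :
  0 < rad -> 0 <= b < 1 -> 0 < S -> (0 <= L)%E -> (0 < n)%N ->
  bounded_domain Omega -> exterior_sphere rad Omega ->
  usc_on (closure Omega) v ->
  (forall F, L = F%:E -> scalar_subsol S F Omega v) -> `|sg| = 1 ->
  (forall p, boundary Omega p -> v p = sg * g p) ->
  C1holder_boundary b Omega g ->
  forall x y, Omega x -> boundary Omega y ->
  (((v x - v y) / enorm (x - y) `^ ((1 + b) / 2))%:E <= (C1_const rad S b)%:E *
    (holder_semi Num.norm 1 (boundary Omega) g
     + holder_semi enorm b (boundary Omega) (grad g) + L))%E.
Proof.
move=> rad0 b01 S0 L0 n0 bd sph usc sub sg1 vg [U [_ bU [dg _ _]]] x y Ox yb.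
have [oO _ _ _] := bd.
have [p pb py] := second_boundary_point oO sph Ox yb.
have G0 := @holder_semi_ge0 R n _ Num.norm 1 _ g p y (fun w : R => normr_ge0 w) pb yb py.
have K0 := @holder_semi_ge0 R n _ enorm b _ (grad g) p y enorm_ge0 pb yb py.
apply: lee_finite_bound; [exact/C1_const_gt0/ltW|by rewrite !adde_ge0|].
move=> t /(nneg_adde_finite (adde_ge0 G0 K0) L0)[GK [F [GKE FE _ F0 ->]]].
have [G [K [GE KE G0' K0' ->]]] := nneg_adde_finite G0 K0 GKE.
rewrite ler_pdivrMr ?powR_gt0 ?enorm_gt0 ?(inside_sub_boundary_neq0 oO Ox yb)//.
apply: (boundary_estimate_C1 rad0 b01 S0 F0 G0' K0' n0 bd sph usc (sub F FE)
  Ox yb sg1 vg).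
- by move=> q /bU /dg.
- move=> q qb; have [->|qy] := eqVneq q y.
    by rewrite !subrr normr0 mulr_ge0 ?enorm_ge0.
  by have := holder_semi_bound GE qb yb qy; rewrite powRr1 ?enorm_ge0.
- move=> q qb; have [->|qy] := eqVneq q y.
    by rewrite !subrr enorm0 mulr_ge0 ?powR_ge0.
  exact: holder_semi_bound KE qb yb qy.
Qed.

End Assembly.

Theorem lemma5p4 (R : realType) (n : nat) (atilde rad : R) (rad_gt0 : 0 < rad) :
  ((forall beta : R, 0 < beta <= 1 ->
    exists2 C : R, 0 < C &
    forall (a : 'I_n -> R) (Omega : set 'rV[R]_n) (f u g : 'rV[R]_n -> R),
      in_Abar a -> mean_coef a = atilde ->
      bounded_domain Omega -> exterior_sphere rad Omega ->
      {within Omega, continuous f} -> [bounded f x | x in Omega] ->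
      {within closure Omega, continuous u} -> visc_sol a Omega f u ->
      (forall y, boundary Omega y -> u y = g y) ->
      (holder_semi Num.norm beta (boundary Omega) g < +oo)%E ->
      (ereal_sup [set ((u x - u y) / enorm (x - y) `^ (beta / 2))%:E
                 | x in Omega & y in boundary Omega]
       <= C%:E * (holder_semi Num.norm beta (boundary Omega) g
                  + Linfty_norm Omega (f^\-)%R))%E)
  /\
  (forall beta L : R, 0 <= beta < 1 ->
    exists2 C : R, 0 < C &
    forall (a : 'I_n -> R) (Omega : set 'rV[R]_n) (f u g : 'rV[R]_n -> R),
      in_Abar a -> mean_coef a = atilde ->
      bounded_domain Omega -> exterior_sphere rad Omega ->
      lipschitz_boundary L Omega ->
      {within Omega, continuous f} -> [bounded f x | x in Omega] ->
      {within closure Omega, continuous u} -> visc_sol a Omega f u ->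
      (forall y, boundary Omega y -> u y = g y) ->
      C1holder_boundary beta Omega g ->
      (ereal_sup [set ((u x - u y) / enorm (x - y) `^ ((1 + beta) / 2))%:E
                 | x in Omega & y in boundary Omega]
       <= C%:E * (holder_semi Num.norm 1 (boundary Omega) g
                  + holder_semi enorm beta (boundary Omega) (grad g)
                  + Linfty_norm Omega (f^\-)%R))%E))
  /\
  ((forall beta : R, 0 < beta <= 1 ->
    exists2 C : R, 0 < C &
    forall (a : 'I_n -> R) (Omega : set 'rV[R]_n) (f u g : 'rV[R]_n -> R),
      in_Abar a -> mean_coef a = atilde ->
      bounded_domain Omega -> exterior_sphere rad Omega ->
      {within Omega, continuous f} -> [bounded f x | x in Omega] ->
      lsc_on (closure Omega) u -> visc_supersol a Omega f u ->
      (forall y, boundary Omega y -> u y = g y) ->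
      (holder_semi Num.norm beta (boundary Omega) g < +oo)%E ->
      (ereal_sup [set ((u y - u x) / enorm (x - y) `^ (beta / 2))%:E
                 | x in Omega & y in boundary Omega]
       <= C%:E * (holder_semi Num.norm beta (boundary Omega) g
                  + Linfty_norm Omega (f^\+)%R))%E)
  /\
  (forall beta L : R, 0 <= beta < 1 ->
    exists2 C : R, 0 < C &
    forall (a : 'I_n -> R) (Omega : set 'rV[R]_n) (f u g : 'rV[R]_n -> R),
      in_Abar a -> mean_coef a = atilde ->
      bounded_domain Omega -> exterior_sphere rad Omega ->
      lipschitz_boundary L Omega ->
      {within Omega, continuous f} -> [bounded f x | x in Omega] ->
      lsc_on (closure Omega) u -> visc_supersol a Omega f u ->
      (forall y, boundary Omega y -> u y = g y) ->
      C1holder_boundary beta Omega g ->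
      (ereal_sup [set ((u y - u x) / enorm (x - y) `^ ((1 + beta) / 2))%:E
                 | x in Omega & y in boundary Omega]
       <= C%:E * (holder_semi Num.norm 1 (boundary Omega) g
                  + holder_semi enorm beta (boundary Omega) (grad g)
                  + Linfty_norm Omega (f^\+)%R))%E)).
Proof.
pose S := `|n%:R * atilde|; have S0 : 0 <= S by exact: normr_ge0.
have ngt0 (a : 'I_n -> R) : in_Abar a -> (0 < n)%N.
  by move=> [_ [j _]]; exact: leq_trans (ltn_ord j).
split; split.
- move=> b b01; exists (holder_const rad S b); first exact: holder_const_gt0.
  move=> a Omega f u g aA am bd sph fc _ uc [_ usub _] ug _.
  have [S_gt0 SE] := sum_coef aA am; have [oO _ _ _] := bd.
  apply: ub_ereal_sup => _ [x Ox [y yb <-]].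
  rewrite /S -SE; apply: (@quotient_bound_holder _ _ _ _ _ _ 1) => //.
  + exact: Linfty_norm_ge0.
  + exact: continuous_usc_on.
  + move=> F FE; apply: subsol_scalar usub _.
    exact: Linfty_norm_funrneg oO fc FE.
  + exact: normr1.
  + by move=> p /ug ->; rewrite mul1r.
- move=> b L b01; exists (C1_const rad S b); first exact: C1_const_gt0.
  move=> a Omega f u g aA am bd sph _ fc _ uc [_ usub _] ug gC1.
  have [S_gt0 SE] := sum_coef aA am; have [oO _ _ _] := bd.
  apply: ub_ereal_sup => _ [x Ox [y yb <-]].
  rewrite /S -SE; apply: (@quotient_bound_C1 _ _ _ _ _ _ 1) => //.
  + exact: Linfty_norm_ge0.
  + exact: ngt0 aA.
  + exact: continuous_usc_on.
  + move=> F FE; apply: subsol_scalar usub _.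
    exact: Linfty_norm_funrneg oO fc FE.
  + exact: normr1.
  + by move=> p /ug ->; rewrite mul1r.
- move=> b b01; exists (holder_const rad S b); first exact: holder_const_gt0.
  move=> a Omega f u g aA am bd sph fc _ ulsc usup ug _.
  have [S_gt0 SE] := sum_coef aA am; have [oO _ _ _] := bd.
  apply: ub_ereal_sup => _ [x Ox [y yb <-]].
  rewrite (_ : u y - u x = (\- u) x - (\- u) y); last by rewrite /= opprK addrC.
  rewrite /S -SE; apply: (@quotient_bound_holder _ _ _ _ _ _ (-1)) => //.
  + exact: Linfty_norm_ge0.
  + exact: lsc_usc_opp.
  + move=> F FE; apply: supersol_scalar usup _.
    exact: Linfty_norm_funrpos oO fc FE.
  + exact: normrN1.
  + by move=> p /ug /= ->; rewrite mulN1r.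
- move=> b L b01; exists (C1_const rad S b); first exact: C1_const_gt0.
  move=> a Omega f u g aA am bd sph _ fc _ ulsc usup ug gC1.
  have [S_gt0 SE] := sum_coef aA am; have [oO _ _ _] := bd.
  apply: ub_ereal_sup => _ [x Ox [y yb <-]].
  rewrite (_ : u y - u x = (\- u) x - (\- u) y); last by rewrite /= opprK addrC.
  rewrite /S -SE; apply: (@quotient_bound_C1 _ _ _ _ _ _ (-1)) => //.
  + exact: Linfty_norm_ge0.
  + exact: ngt0 aA.
  + exact: lsc_usc_opp.
  + move=> F FE; apply: supersol_scalar usup _.
    exact: Linfty_norm_funrpos oO fc FE.
  + exact: normrN1.
  + by move=> p /ug /= ->; rewrite mulN1r.
Qed.
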